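(* Let $\mathscr{C}$ be a category with finite limits, $\mathscr{P}$ a projective class in $\mathscr{C}$, $\mathscr{B}$ an abelian category, and $F\colon\mathscr{C}\to\mathscr{B}$ a functor. Let $\mathbb{Z}\mathscr{C}$ be the free preadditive category generated by $\mathscr{C}$, $F_{ad}\colon\mathbb{Z}\mathscr{C}\to\mathscr{B}$ the unique additive extension of $F$, $\widetilde{\mathbb{Z}\mathscr{C}}$ the idempotent completion of $\mathbb{Z}\mathscr{C}$, and $\overline{\mathscr{P}}$ the closure of $\mathscr{P}$ in $\widetilde{\mathbb{Z}\mathscr{C}}$. Then: (i) For any $\mathscr{P}$-projective pseudocubical resolution $X\to C$ of an object $C\in\mathscr{C}$, the augmented chain complex $N(X)\to C$ in the category $\widetilde{\mathbb{Z}\mathscr{C}}$ is a $\overline{\mathscr{P}}$-resolution of $C$. (ii) For any $C\in\mathscr{C}$, there is a natural isomorphism $$\mathbf{L}^{\Box}_nF(C)\cong\mathbf{L}^{\mathscr{P}}_nF_{ad}(C),\qquad n\ge0,$$ between the cubical derived functors of $F$ with respect to $\mathscr{P}$ and the (Eilenberg–Moore) left derived functors of $F_{ad}$ with respect to the class $\mathscr{P}$ of objects of $\mathbb{Z}\mathscr{C}$.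
   Context: **Free preadditive category.** $\mathbb{Z}\mathscr{C}$ has the objects of $\mathscr{C}$, $\mathrm{Hom}_{\mathbb{Z}\mathscr{C}}(C,D)=\mathbb{Z}[\mathrm{Hom}_{\mathscr{C}}(C,D)]$ (free abelian group), and composition is the bilinear extension of that of $\mathscr{C}$. $F_{ad}$ agrees with $F$ on objects and $F_{ad}(\sum n_if_i)=\sum n_iF(f_i)$. A preadditive category is one whose Hom-sets are abelian groups with bilinear composition. **Idempotent completion.** A preadditive category is idempotent complete if every idempotent $p\colon E\to E$, $p^2=p$, has a kernel. Every preadditive category $\mathscr{A}$ has an idempotent completion: a full additive embedding $\mathscr{A}\to\widetilde{\mathscr{A}}$ into an idempotent complete preadditive category, universal in that every additive functor from $\mathscr{A}$ to an idempotent complete preadditive category extends to $\widetilde{\mathscr{A}}$ (up to natural isomorphism), uniquely up to natural isomorphism. $\mathscr{C}$ is regarded as a subcategory of $\mathbb{Z}\mathscr{C}\subseteq\widetilde{\mathbb{Z}\mathscr{C}}$. **Projective class.** A morphism $f\colon X\to Y$ of $\mathscr{C}$ is a $\mathscr{P}$-epimorphism if $f_*\colon \mathrm{Hom}_{\mathscr{C}}(Q,X)\to \mathrm{Hom}_{\mathscr{C}}(Q,Y)$ is surjective for all $Q\in\mathscr{P}$. A class $\mathscr{P}$ of objects is a projective class if for every $C\in\mathscr{C}$ there is a $\mathscr{P}$-epimorphism $P\to C$ with $P\in\mathscr{P}$. **Closure.** Given a class $\mathscr{P}$ of objects in a preadditive category $\mathscr{A}$, a sequence $X\xrightarrow{f}Y\xrightarrow{g}Z$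 is $\mathscr{P}$-exact if $gf=0$ and $\mathrm{Hom}(P,X)\to\mathrm{Hom}(P,Y)\to\mathrm{Hom}(P,Z)$ is exact for all $P\in\mathscr{P}$. The closure $\overline{\mathscr{P}}$ of $\mathscr{P}$ in $\mathscr{A}$ is the class of all $Q\in\mathscr{A}$ such that $\mathrm{Hom}(Q,X)\to\mathrm{Hom}(Q,Y)\to\mathrm{Hom}(Q,Z)$ is exact for every $\mathscr{P}$-exact sequence $X\to Y\to Z$. **Pseudocubical objects and resolutions.** A pseudocubical object $X$ is a family $(X_n)_{n\ge0}$ with faces $\partial_i^0,\partial_i^1\colon X_n\to X_{n-1}$ and pseudodegeneracies $s_i\colon X_{n-1}\to X_n$ ($n\ge1$, $1\le i\le n$) satisfying, for $\alpha,\varepsilon\in\{0,1\}$, $\partial_i^\alpha\partial_j^\varepsilon=\partial_{j-1}^\varepsilon\partial_i^\alpha$ for $i<j$, and $\partial_i^\alpha s_j=s_{j-1}\partial_i^\alpha$ for $i<j$, $\partial_i^\alpha s_i=\mathrm{id}$, $\partial_i^\alpha s_j=s_j\partial_{i-1}^\alpha$ for $i>j$. An augmentation over $C$ is a morphism $\partial\colon X_0\to C$ with $\partial\partial_1^0=\partial\partial_1^1$. The augmented object $X\to C$ is $\mathscr{P}$-exact if for every $Q\in\mathscr{P}$: (a) $\mathrm{Hom}(Q,X_0)\to\mathrm{Hom}(Q,C)$ is surjective; (b) for $x,y\in\mathrm{Hom}(Q,X_0)$ with $\partial x=\partial y$ there is $z\in\mathrm{Hom}(Q,X_1)$ with $\partial_1^0z=x$,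 $\partial_1^1z=y$; (c) for $n\ge1$ and any $x_i^\varepsilon\in\mathrm{Hom}(Q,X_n)$ ($1\le i\le n+1$, $\varepsilon\in\{0,1\}$) with $\partial_i^\alpha x_j^\varepsilon=\partial_{j-1}^\varepsilon x_i^\alpha$ for $1\le i<j\le n+1$, $\alpha,\varepsilon\in\{0,1\}$, there is $x\in\mathrm{Hom}(Q,X_{n+1})$ with $\partial_i^\varepsilon x=x_i^\varepsilon$ for all $i,\varepsilon$. (Hom is taken in $\mathscr{C}$.) A $\mathscr{P}$-projective pseudocubical resolution of $C$ is a $\mathscr{P}$-exact augmented pseudocubical object $X\to C$ in $\mathscr{C}$ with all $X_n\in\mathscr{P}$; these exist for every $C$. **Normalization.** For a pseudocubical object $X$ in an idempotent complete preadditive category, let $C(X)$ be the chain complex $C(X)_n=X_n$, $\partial=\sum_{i=1}^n(-1)^i(\partial_i^1-\partial_i^0)$. The morphisms $\sigma^X_n=(1-s_1\partial_1^1)(1-s_2\partial_2^1)\cdots(1-s_n\partial_n^1)\colon X_n\to X_n$ ($\sigma_0^X=1$) are idempotents and form a chain map $\sigma^X\colon C(X)\to C(X)$. The normalized chain complex is $N(X)=\mathrm{Ker}(1-\sigma^X)$, the kernel in non-negative chain complexes (computed degreewise). In an abelian category, $N(X)_0=X_0$, $N(X)_n=\bigcap_{i=1}^n\mathrm{Ker}(\partial_i^1)$ with $\partial=\sum_{i=1}^n(-1)^{i+1}\partial_i^0$. In (i), $X$ is regarded as a pseudocubical object of $\widetilde{\mathbb{Z}\mathscr{C}}$ and $N(X)$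 is augmented by $\partial\colon N(X)_0=X_0\to C$. **Cubical derived functors.** $\mathbf{L}^{\Box}_nF(C)=H_n(N(F(X)))$ for a chosen $\mathscr{P}$-projective pseudocubical resolution $X\to C$; morphisms $C\to C'$ extend to maps of resolutions commuting with faces and augmentations, uniquely up to precubical homotopy, and $N$ is homotopy invariant, so this is a well-defined functor. **Resolutions and Eilenberg–Moore derived functors.** Let $\mathscr{A}$ be a preadditive category and $\mathscr{Q}$ any class of objects of $\mathscr{A}$. A complex over $A\in\mathscr{A}$ is a sequence $\cdots\to C_1\xrightarrow{\partial_1}C_0\xrightarrow{\partial_0}A$ with $\partial_n\partial_{n+1}=0$ for $n\ge0$. It is $\mathscr{Q}$-acyclic if for every $Q\in\mathscr{Q}$ the sequence $\cdots\to\mathrm{Hom}(Q,C_1)\to\mathrm{Hom}(Q,C_0)\to\mathrm{Hom}(Q,A)\to0$ is exact. A $\mathscr{Q}$-resolution of $A$ is a $\mathscr{Q}$-acyclic complex $P_*\to A$ over $A$ with all $P_n\in\mathscr{Q}$. For an additive functor $G\colon\mathscr{A}\to\mathscr{B}$ to an abelian category, $\mathbf{L}^{\mathscr{Q}}_nG(A)=H_n(G(P_* ))$ for a chosen $\mathscr{Q}$-resolution $P_*\to A$; this is a functor on the full subcategory of objects possessing $\mathscr{Q}$-resolutions (morphisms extend to chain maps of resolutions, uniquely up to chain homotopy). Every object of $\mathscr{C}$ possesses a $\mathscr{P}$-resolution in $\mathbb{Z}\mathscr{C}$. *)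

(* Defs.v *)
From HB Require Import structures.
From mathcomp Require Import all_boot all_order all_algebra.
From mathcomp Require Import boolp classical_sets cardinality.
From mathcomp Require Import freeg.

Set Implicit Arguments.
Unset Strict Implicit.
Unset Printing Implicit Defensive.

Import GRing.Theory.
Local Open Scope ring_scope.
Local Open Scope classical_set_scope.

Record category := Category {
  ob :> Type;
  hom : ob -> ob -> Type;
  idm : forall X, hom X X;
  mcomp : forall X Y Z, hom Y Z -> hom X Y -> hom X Z;
  comp1m : forall X Y (f : hom X Y), mcomp (idm Y) f = f;
  compm1 : forall X Y (f : hom X Y), mcomp f (idm X) = f;
  compmA : forall X Y Z W (h : hom Z W) (g : hom Y Z) (f : hom X Y),
    mcomp h (mcomp g f) = mcomp (mcomp h g) f
}.

Arguments hom {c} X Y.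
Arguments idm {c} X.
Arguments mcomp {c X Y Z} g f.

Notation "g \oc f" := (mcomp g f) (at level 40, left associativity).

Record functor (C D : category) := Functor {
  fob :> C -> D;
  fmap : forall X Y : C, hom X Y -> hom (fob X) (fob Y);
  fmap1 : forall X, fmap (idm X) = idm (fob X);
  fmapM : forall (X Y Z : C) (g : hom Y Z) (f : hom X Y),
    fmap (g \oc f) = fmap g \oc fmap f
}.

Arguments fmap {C D} F {X Y} f : rename.

Section FunctorComp.
Variables (C D E : category) (G : functor D E) (F : functor C D).

Lemma comp_fmap1 (X : C) : fmap G (fmap F (idm X)) = idm (G (F X)).
Proof. by rewrite !fmap1. Qed.

Lemma comp_fmapM (X Y Z : C) (g : hom Y Z) (f : hom X Y) :
  fmap G (fmap F (g \oc f)) = fmap G (fmap F g) \oc fmap G (fmap F f).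
Proof. by rewrite !fmapM. Qed.

Definition compF : functor C E :=
  @Functor C E (fun X => G (F X)) (fun X Y f => fmap G (fmap F f))
    comp_fmap1 comp_fmapM.
End FunctorComp.

Definition is_isom (C : category) (X Y : C) (f : hom X Y) : Prop :=
  exists g : hom Y X, g \oc f = idm X /\ f \oc g = idm Y.

Definition nat_iso (C D : category) (F G : functor C D) : Prop :=
  exists eta : forall X, hom (F X) (G X),
    (forall X, is_isom (eta X)) /\
    (forall (X Y : C) (f : hom X Y), fmap G f \oc eta X = eta Y \oc fmap F f).

Definition is_cone (J C : category) (D : functor J C) (L : C)
    (p : forall j, hom L (D j)) : Prop :=
  forall (i j : J) (u : hom i j), fmap D u \oc p i = p j.

Definition is_limit (J C : category) (D : functor J C) (L : C)
    (p : forall j, hom L (D j)) : Prop :=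
  is_cone p /\
  forall (M : C) (q : forall j, hom M (D j)), is_cone q ->
    exists! h : hom M L, forall j, p j \oc h = q j.

Definition finite_category (J : category) : Prop :=
  finite_set [set: J] /\ forall i j : J, finite_set [set: hom i j].

Definition has_finite_limits (C : category) : Prop :=
  forall (J : category) (D : functor J C), finite_category J ->
    exists (L : C) (p : forall j, hom L (D j)), is_limit p.

Record preadditive := Preadditive {
  base :> category;
  addm : forall X Y : base, hom X Y -> hom X Y -> hom X Y;
  zerom : forall X Y : base, hom X Y;
  oppm : forall X Y : base, hom X Y -> hom X Y;
  addmA : forall X Y : base, associative (@addm X Y);
  addmC : forall X Y : base, commutative (@addm X Y);
  add0m : forall X Y : base, left_id (@zerom X Y) (@addm X Y);
  addNm : forall X Y : base, left_inverse (@zerom X Y) (@oppm X Y) (@addm X Y);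
  comp_addl : forall (X Y Z : base) (g g' : hom Y Z) (f : hom X Y),
    addm g g' \oc f = addm (g \oc f) (g' \oc f);
  comp_addr : forall (X Y Z : base) (g : hom Y Z) (f f' : hom X Y),
    g \oc addm f f' = addm (g \oc f) (g \oc f')
}.

HB.instance Definition _ (A : preadditive) (X Y : A) := gen_eqMixin (hom X Y).
HB.instance Definition _ (A : preadditive) (X Y : A) :=
  gen_choiceMixin (hom X Y).
HB.instance Definition _ (A : preadditive) (X Y : A) :=
  GRing.isZmodule.Build (hom X Y) (@addmA A X Y) (@addmC A X Y)
    (@add0m A X Y) (@addNm A X Y).

Section PreadditiveTheory.
Variable A : preadditive.
Implicit Types X Y Z : A.

Lemma compDm X Y Z (g g' : hom Y Z) (f : hom X Y) :
  (g + g') \oc f = g \oc f + g' \oc f.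
Proof. exact: comp_addl. Qed.

Lemma compmD X Y Z (g : hom Y Z) (f f' : hom X Y) :
  g \oc (f + f') = g \oc f + g \oc f'.
Proof. exact: comp_addr. Qed.

Lemma comp0m X Y Z (f : hom X Y) : (0 : hom Y Z) \oc f = 0.
Proof. by apply: (addrI (0 \oc f)); rewrite -compDm !addr0. Qed.

Lemma compm0 X Y Z (g : hom Y Z) : g \oc (0 : hom X Y) = 0.
Proof. by apply: (addrI (g \oc 0)); rewrite -compmD !addr0. Qed.

Lemma compNm X Y Z (g : hom Y Z) (f : hom X Y) : (- g) \oc f = - (g \oc f).
Proof. by apply: (addrI (g \oc f)); rewrite -compDm !subrr comp0m. Qed.

Lemma compmN X Y Z (g : hom Y Z) (f : hom X Y) : g \oc (- f) = - (g \oc f).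
Proof. by apply: (addrI (g \oc f)); rewrite -compmD !subrr compm0. Qed.

Lemma compBm X Y Z (g g' : hom Y Z) (f : hom X Y) :
  (g - g') \oc f = g \oc f - g' \oc f.
Proof. by rewrite compDm compNm. Qed.

Lemma compmB X Y Z (g : hom Y Z) (f f' : hom X Y) :
  g \oc (f - f') = g \oc f - g \oc f'.
Proof. by rewrite compmD compmN. Qed.

Lemma compzm X Y Z (g : hom Y Z) (f : hom X Y) (z : int) :
  (g *~ z) \oc f = (g \oc f) *~ z.
Proof.
have Hn n : (g *+ n) \oc f = (g \oc f) *+ n.
  by elim: n => [|n IH]; rewrite ?mulr0n ?comp0m // !mulrS compDm IH.
by case: z => n; rewrite -?pmulrn ?NegzE -?nmulrn ?compNm Hn.
Qed.

Lemma compmz X Y Z (g : hom Y Z) (f : hom X Y) (z : int) :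
  g \oc (f *~ z) = (g \oc f) *~ z.
Proof.
have Hn n : g \oc (f *+ n) = (g \oc f) *+ n.
  by elim: n => [|n IH]; rewrite ?mulr0n ?compm0 // !mulrS compmD IH.
by case: z => n; rewrite -?pmulrn ?NegzE -?nmulrn ?compmN Hn.
Qed.

Lemma comp_suml (I : Type) (r : seq I) (Q : pred I) X Y Z
    (G : I -> hom Y Z) (f : hom X Y) :
  (\sum_(i <- r | Q i) G i) \oc f = \sum_(i <- r | Q i) (G i \oc f).
Proof.
by elim/big_rec2: _ => [|i y1 y2 _ <-]; rewrite ?comp0m // compDm.
Qed.

Lemma comp_sumr (I : Type) (r : seq I) (Q : pred I) X Y Z
    (g : hom Y Z) (G : I -> hom X Y) :
  g \oc (\sum_(i <- r | Q i) G i) = \sum_(i <- r | Q i) (g \oc G i).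
Proof.
by elim/big_rec2: _ => [|i y1 y2 _ <-]; rewrite ?compm0 // compmD.
Qed.

End PreadditiveTheory.

Record additive_functor (A B : preadditive) := AdditiveFunctor {
  afun :> functor A B;
  afunD : forall (X Y : A) (f g : hom X Y),
    fmap afun (f + g) = fmap afun f + fmap afun g
}.

Lemma afun0 (A B : preadditive) (G : additive_functor A B) (X Y : A) :
  fmap G (0 : hom X Y) = 0.
Proof. by apply: (addrI (fmap G (0 : hom X Y))); rewrite -afunD !addr0. Qed.

Section FreeLift.
Variables (T : Type) (V : zmodType) (h : T -> V).

(* the homomorphism sum n_i t_i |-> sum n_i h(t_i) *)
Definition free_lift (D : {freeg {classic T}}) : V :=
  \sum_(t <- dom D) h t *~ coeff t D.

Lemma free_lift_subset (s : seq {classic T}) (D : {freeg {classic T}}) :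
  uniq s -> {subset dom D <= s} ->
  free_lift D = \sum_(t <- s) h t *~ coeff t D.
Proof.
move=> us sub; rewrite /free_lift.
rewrite [RHS](bigID (fun t => t \in dom D)) /= [X in _ + X]big1 ?addr0; last first.
  by move=> t /coeff_outdom ->; rewrite mulr0z.
rewrite -[RHS]big_filter; apply: perm_big; apply: uniq_perm.
- exact: uniq_dom.
- exact: filter_uniq.
by move=> t; rewrite mem_filter; case: (boolP (t \in dom D)) => // /sub ->.
Qed.

Lemma free_liftD D1 D2 : free_lift (D1 + D2) = free_lift D1 + free_lift D2.
Proof.
pose s := undup (dom D1 ++ dom D2).
have us : uniq s by exact: undup_uniq.
rewrite !(@free_lift_subset s) //.
- by rewrite -big_split; apply: eq_bigr => t _; rewrite coeffD mulrzDr.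
- by move=> t tD; rewrite mem_undup mem_cat tD orbT.
- by move=> t tD; rewrite mem_undup mem_cat tD.
- by move=> t /domD_subset; rewrite mem_undup.
Qed.

Lemma free_liftU (t : {classic T}) : free_lift << t >> = h t.
Proof. by rewrite /free_lift domU1 big_seq1 coeffU eqxx mulr1. Qed.

Lemma free_lift0 : free_lift 0 = 0.
Proof. by rewrite /free_lift dom0 big_nil. Qed.

Lemma free_liftN D : free_lift (- D) = - free_lift D.
Proof. by apply: (addrI (free_lift D)); rewrite -free_liftD !subrr free_lift0. Qed.

Lemma free_liftz (z : int) (t : {classic T}) : free_lift << z *g t >> = h t *~ z.
Proof.
have Hn n : free_lift (<< t >> *+ n) = h t *+ n.
  elim: n => [|n IH]; first by rewrite !mulr0n free_lift0.
  by rewrite !mulrS free_liftD IH free_liftU.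
rewrite -[z]intz -freegU_mulz; case: z => n.
  by rewrite -pmulrn Hn intz -pmulrn.
by rewrite NegzE -nmulrn free_liftN Hn intz -nmulrn.
Qed.
End FreeLift.

Lemma free_lift_add (T : Type) (V : zmodType) (h h1 h2 : T -> V) D :
  (forall t, h t = h1 t + h2 t) ->
  free_lift h D = free_lift h1 D + free_lift h2 D.
Proof.
move=> hE; rewrite /free_lift -big_split; apply: eq_bigr => t _.
by rewrite hE mulrzDl.
Qed.

Lemma freegW (T : Type) (Q : {freeg {classic T}} -> Prop) :
  Q 0 -> (forall D1 D2, Q D1 -> Q D2 -> Q (D1 + D2)) -> (forall D, Q D -> Q (- D)) ->
  (forall t, Q << t >>) -> forall D, Q D.
Proof.
move=> Q0 QD QN QU D; rewrite -[D]freeg_sumE; elim/big_ind: _ => // t _.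
have Qn n : Q (<< t >> *+ n).
  by elim: n => [|n IH]; rewrite ?mulr0n // mulrS; apply: QD.
rewrite -[coeff t D]intz -freegU_mulz; case: (coeff t D) => n.
  by rewrite -pmulrn.
by rewrite NegzE -nmulrn; apply: QN.
Qed.

Section FreePreadditive.
Variable C : category.

Definition free_hom (X Y : C) : Type := {freeg {classic @hom C X Y}}.

Definition free_id (X : C) : free_hom X X := << (idm X : {classic hom X X}) >>.

Definition free_comp (X Y Z : C) (g : free_hom Y Z) (f : free_hom X Y) :
    free_hom X Z :=
  free_lift (fun v : hom Y Z => free_lift (fun u : hom X Y =>
    << (v \oc u : {classic hom X Z}) >> : {freeg {classic hom X Z}}) f) g.

Lemma free_compDl (X Y Z : C) (g g' : free_hom Y Z) (f : free_hom X Y) :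
  free_comp (g + g') f = free_comp g f + free_comp g' f.
Proof. exact: free_liftD. Qed.

Lemma free_compDr (X Y Z : C) (g : free_hom Y Z) (f f' : free_hom X Y) :
  free_comp g (f + f') = free_comp g f + free_comp g f'.
Proof. by apply: free_lift_add => v; rewrite free_liftD. Qed.

Lemma free_compNl (X Y Z : C) (g : free_hom Y Z) (f : free_hom X Y) :
  free_comp (- g) f = - free_comp g f.
Proof. exact: free_liftN. Qed.

Lemma free_comp0l (X Y Z : C) (f : free_hom X Y) :
  free_comp (0 : free_hom Y Z) f = 0.
Proof. exact: free_lift0. Qed.

Lemma free_comp0r (X Y Z : C) (g : free_hom Y Z) :
  free_comp g (0 : free_hom X Y) = 0.
Proof.
by apply: (addrI (free_comp g 0)); rewrite -free_compDr !addr0.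
Qed.

Lemma free_compNr (X Y Z : C) (g : free_hom Y Z) (f : free_hom X Y) :
  free_comp g (- f) = - free_comp g f.
Proof.
by apply: (addrI (free_comp g f)); rewrite -free_compDr !subrr free_comp0r.
Qed.

Lemma free_compU (X Y Z : C) (g : hom Y Z) (f : hom X Y) :
  free_comp << (g : {classic _}) >> << (f : {classic _}) >>
    = << (g \oc f : {classic _}) >>.
Proof. by rewrite /free_comp !free_liftU. Qed.

Lemma free_comp1m (X Y : C) (f : free_hom X Y) : free_comp (free_id Y) f = f.
Proof.
elim/freegW: f => [|f g Hf Hg|f Hf|f]; first exact: free_comp0r.
- by rewrite free_compDr Hf Hg.
- by rewrite free_compNr Hf.
by rewrite /free_id free_compU comp1m.
Qed.

Lemma free_compm1 (X Y : C) (f : free_hom X Y) : free_comp f (free_id X) = f.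
Proof.
elim/freegW: f => [|f g Hf Hg|f Hf|f]; first exact: free_comp0l.
- by rewrite free_compDl Hf Hg.
- by rewrite free_compNl Hf.
by rewrite /free_id free_compU compm1.
Qed.

Lemma free_compmA (X Y Z W : C) (h : free_hom Z W) (g : free_hom Y Z)
    (f : free_hom X Y) :
  free_comp h (free_comp g f) = free_comp (free_comp h g) f.
Proof.
elim/freegW: h => [|h h' Hh Hh'|h Hh|h]; first by rewrite !free_comp0l.
- by rewrite !free_compDl Hh Hh'.
- by rewrite !free_compNl Hh.
elim/freegW: g => [|g g' Hg Hg'|g Hg|g].
- by rewrite free_comp0l !free_comp0r free_comp0l.
- by rewrite !(free_compDl, free_compDr) Hg Hg'.
- by rewrite !(free_compNl, free_compNr) Hg.
elim/freegW: f => [|f f' Hf Hf'|f Hf|f].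
- by rewrite !free_comp0r.
- by rewrite !free_compDr Hf Hf'.
- by rewrite !free_compNr Hf.
by rewrite !free_compU compmA.
Qed.

Definition free_category : category :=
  @Category C free_hom free_id free_comp free_comp1m free_compm1 free_compmA.

Definition free_preadditive : preadditive :=
  @Preadditive free_category
    (fun X Y (f g : free_hom X Y) => f + g) (fun X Y => 0 : free_hom X Y)
    (fun X Y (f : free_hom X Y) => - f)
    (fun X Y => @addrA {freeg {classic @hom C X Y}})
    (fun X Y => @addrC {freeg {classic @hom C X Y}})
    (fun X Y => @add0r {freeg {classic @hom C X Y}})
    (fun X Y => @addNr {freeg {classic @hom C X Y}})
    free_compDl free_compDr.

Definition free_incl : functor C free_preadditive :=
  @Functor C free_preadditive (fun X => X)
    (fun X Y (f : hom X Y) => << (f : {classic hom X Y}) >>)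
    (fun X => erefl) (fun X Y Z g f => esym (free_compU g f)).

Section FreeExtension.
Variables (B : preadditive) (F : functor C B).

Definition free_ext_map (X Y : C) (f : free_hom X Y) : hom (F X) (F Y) :=
  free_lift (fun u : hom X Y => fmap F u) f.

Lemma free_ext_map1 X : free_ext_map (free_id X) = idm (F X).
Proof. by rewrite /free_ext_map free_liftU fmap1. Qed.

Lemma free_ext_mapM (X Y Z : C) (g : free_hom Y Z) (f : free_hom X Y) :
  free_ext_map (free_comp g f) = free_ext_map g \oc free_ext_map f.
Proof.
elim/freegW: g => [|g g' Hg Hg'|g Hg|g].
- by rewrite free_comp0l /free_ext_map !free_lift0 comp0m.
- rewrite free_compDl /free_ext_map !free_liftD compDm.
  by rewrite -!/(free_ext_map _) Hg Hg'.
- by rewrite free_compNl /free_ext_map !free_liftN compNm -!/(free_ext_map _) Hg.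
elim/freegW: f => [|f f' Hf Hf'|f Hf|f].
- by rewrite free_comp0r /free_ext_map !free_lift0 compm0.
- rewrite free_compDr /free_ext_map !free_liftD compmD.
  by rewrite -!/(free_ext_map _) Hf Hf'.
- by rewrite free_compNr /free_ext_map !free_liftN compmN -!/(free_ext_map _) Hf.
by rewrite free_compU /free_ext_map !free_liftU fmapM.
Qed.

(* F_ad *)
Definition free_ext : additive_functor free_preadditive B :=
  @AdditiveFunctor free_preadditive B
    (@Functor free_preadditive B F free_ext_map free_ext_map1 free_ext_mapM)
    (fun X Y => free_liftD (fun u : @hom C X Y => fmap F u)).

End FreeExtension.
End FreePreadditive.

Section Kernels.
Variable A : preadditive.
Implicit Types X Y Z K : A.

Definition is_kernel X Y K (f : hom X Y) (k : hom K X) : Prop :=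
  f \oc k = 0 /\
  forall Z (g : hom Z X), f \oc g = 0 -> exists! h : hom Z K, k \oc h = g.

Definition is_cokernel X Y K (f : hom X Y) (k : hom Y K) : Prop :=
  k \oc f = 0 /\
  forall Z (g : hom Y Z), g \oc f = 0 -> exists! h : hom K Z, h \oc k = g.

Definition monic_hom X Y (f : hom X Y) : Prop :=
  forall Z (g h : hom Z X), f \oc g = f \oc h -> g = h.

Definition epic_hom X Y (f : hom X Y) : Prop :=
  forall Z (g h : hom Y Z), g \oc f = h \oc f -> g = h.

Record kernel_of X Y (f : hom X Y) := KernelOf {
  ker_ob :> A;
  ker_map : hom ker_ob X;
  ker_mapP : is_kernel f ker_map
}.

Record cokernel_of X Y (f : hom X Y) := CokernelOf {
  coker_ob :> A;
  coker_map : hom Y coker_ob;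
  coker_mapP : is_cokernel f coker_map
}.

Lemma choose_kernel X Y (f : hom X Y) :
  (exists K (k : hom K X), is_kernel f k) -> kernel_of f.
Proof. by move=> /cid [K] /cid [k kP]; exists K k. Qed.

Lemma choose_cokernel X Y (f : hom X Y) :
  (exists K (k : hom Y K), is_cokernel f k) -> cokernel_of f.
Proof. by move=> /cid [K] /cid [k kP]; exists K k. Qed.

Section KernelTheory.
Variables (X Y : A) (f : hom X Y) (K : kernel_of f).

Lemma ker_map0 : f \oc ker_map K = 0.
Proof. exact: (ker_mapP K).1. Qed.

Lemma ker_map_inj : monic_hom (ker_map K).
Proof.
move=> Z g h e; have e0 : f \oc (ker_map K \oc h) = 0.
  by rewrite compmA ker_map0 comp0m.
have [u [_ uP]] := (ker_mapP K).2 Z _ e0.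
by rewrite -(uP g e) -(uP h erefl).
Qed.

Definition ker_lift Z (g : hom Z X) (g0 : f \oc g = 0) : hom Z K :=
  projT1 (cid ((ker_mapP K).2 Z g g0)).

Lemma ker_liftE Z (g : hom Z X) (g0 : f \oc g = 0) :
  ker_map K \oc ker_lift g0 = g.
Proof. by rewrite /ker_lift; case: cid => h []. Qed.
End KernelTheory.

Section CokernelTheory.
Variables (X Y : A) (f : hom X Y) (K : cokernel_of f).

Lemma coker_map0 : coker_map K \oc f = 0.
Proof. exact: (coker_mapP K).1. Qed.

Lemma coker_map_inj : epic_hom (coker_map K).
Proof.
move=> Z g h e; have e0 : (h \oc coker_map K) \oc f = 0.
  by rewrite -compmA coker_map0 compm0.
have [u [_ uP]] := (coker_mapP K).2 Z _ e0.
by rewrite -(uP g e) -(uP h erefl).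
Qed.

Definition coker_lift Z (g : hom Y Z) (g0 : g \oc f = 0) : hom K Z :=
  projT1 (cid ((coker_mapP K).2 Z g g0)).

Lemma coker_liftE Z (g : hom Y Z) (g0 : g \oc f = 0) :
  coker_lift g0 \oc coker_map K = g.
Proof. by rewrite /coker_lift; case: cid => h []. Qed.
End CokernelTheory.

Definition idempotent_complete : Prop :=
  forall (E : A) (p : hom E E), p \oc p = p ->
    exists (K : A) (k : hom K E), is_kernel p k.

Definition is_zero_object (Z : A) : Prop :=
  forall X, (exists! f : hom X Z, True) /\ (exists! f : hom Z X, True).

Definition is_product X Y Z (p : hom Z X) (q : hom Z Y) : Prop :=
  forall W (f : hom W X) (g : hom W Y),
    exists! h : hom W Z, p \oc h = f /\ q \oc h = g.

End Kernels.

(* I : A -> A' is the idempotent completion of A *)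
Record idempotent_completion (A A' : preadditive) (I : additive_functor A A')
    : Prop := IdempotentCompletion {
  compl_full : forall (X Y : A) (g : hom (I X) (I Y)),
    exists f : hom X Y, fmap I f = g;
  compl_faithful : forall (X Y : A) (f g : hom X Y),
    fmap I f = fmap I g -> f = g;
  compl_complete : idempotent_complete A';
  compl_extend : forall (D : preadditive) (G : additive_functor A D),
    idempotent_complete D ->
    exists G' : additive_functor A' D, nat_iso (compF G' I) G;
  compl_unique : forall (D : preadditive) (G G' : additive_functor A' D),
    idempotent_complete D ->
    nat_iso (compF G I) (compF G' I) -> nat_iso G G'
}.

Section Karoubi.
Variable A : preadditive.

Record kar_ob := KarOb {
  kar_base :> A;
  kar_idem : hom kar_base kar_base;
  kar_idemK : kar_idem \oc kar_idem = kar_idem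
}.

Definition kar_homP (X Y : kar_ob) (f : hom X Y) : Prop :=
  kar_idem Y \oc f = f /\ f \oc kar_idem X = f.

Definition kar_hom (X Y : kar_ob) : Type := {f : hom X Y | kar_homP f}.

Lemma kar_eq (X Y : kar_ob) (f g : kar_hom X Y) : sval f = sval g -> f = g.
Proof. by case: f g => [f ?] [g ?] /= fg; exact: eq_exist. Qed.

Definition kar_id (X : kar_ob) : kar_hom X X :=
  exist _ (kar_idem X) (conj (kar_idemK X) (kar_idemK X)).

Lemma kar_comp_subproof (X Y Z : kar_ob) (g : kar_hom Y Z) (f : kar_hom X Y) :
  kar_homP (sval g \oc sval f).
Proof.
case: g f => [g [g1 g2]] [f [f1 f2]]; split=> /=.
  by rewrite compmA g1.
by rewrite -compmA f2.
Qed.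

Definition kar_comp (X Y Z : kar_ob) (g : kar_hom Y Z) (f : kar_hom X Y) :
    kar_hom X Z :=
  exist _ (sval g \oc sval f) (kar_comp_subproof g f).

Lemma kar_comp1m (X Y : kar_ob) (f : kar_hom X Y) : kar_comp (kar_id Y) f = f.
Proof. by apply: kar_eq; case: f => f []. Qed.

Lemma kar_compm1 (X Y : kar_ob) (f : kar_hom X Y) : kar_comp f (kar_id X) = f.
Proof. by apply: kar_eq; case: f => f []. Qed.

Lemma kar_compmA (X Y Z W : kar_ob) (h : kar_hom Z W) (g : kar_hom Y Z)
    (f : kar_hom X Y) :
  kar_comp h (kar_comp g f) = kar_comp (kar_comp h g) f.
Proof. by apply: kar_eq; rewrite /= compmA. Qed.

Definition kar_category : category :=
  @Category kar_ob kar_hom kar_id kar_comp kar_comp1m kar_compm1 kar_compmA.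

Lemma kar_add_subproof (X Y : kar_ob) (f g : kar_hom X Y) :
  kar_homP (sval f + sval g).
Proof.
by case: f g => [f [f1 f2]] [g [g1 g2]]; split; rewrite /= ?compmD ?compDm ?f1 ?f2 ?g1 ?g2.
Qed.

Lemma kar_zero_subproof (X Y : kar_ob) : @kar_homP X Y 0.
Proof. by split; rewrite ?compm0 ?comp0m. Qed.

Lemma kar_opp_subproof (X Y : kar_ob) (f : kar_hom X Y) : kar_homP (- sval f).
Proof. by case: f => [f [f1 f2]]; split; rewrite /= ?compmN ?compNm ?f1 ?f2. Qed.

Definition kar_add (X Y : kar_ob) (f g : kar_hom X Y) : kar_hom X Y :=
  exist _ _ (kar_add_subproof f g).
Definition kar_zero (X Y : kar_ob) : kar_hom X Y :=
  exist _ _ (kar_zero_subproof X Y).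
Definition kar_opp (X Y : kar_ob) (f : kar_hom X Y) : kar_hom X Y :=
  exist _ _ (kar_opp_subproof f).

Lemma kar_addA (X Y : kar_ob) : associative (@kar_add X Y).
Proof. by move=> f g h; apply: kar_eq; rewrite /= addrA. Qed.
Lemma kar_addC (X Y : kar_ob) : commutative (@kar_add X Y).
Proof. by move=> f g; apply: kar_eq; rewrite /= addrC. Qed.
Lemma kar_add0 (X Y : kar_ob) : left_id (@kar_zero X Y) (@kar_add X Y).
Proof. by move=> f; apply: kar_eq; rewrite /= add0r. Qed.
Lemma kar_addN (X Y : kar_ob) :
  left_inverse (@kar_zero X Y) (@kar_opp X Y) (@kar_add X Y).
Proof. by move=> f; apply: kar_eq; rewrite /= addNr. Qed.
Lemma kar_comp_addl (X Y Z : kar_ob) (g g' : kar_hom Y Z) (f : kar_hom X Y) :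
  kar_comp (kar_add g g') f = kar_add (kar_comp g f) (kar_comp g' f).
Proof. by apply: kar_eq; rewrite /= compDm. Qed.
Lemma kar_comp_addr (X Y Z : kar_ob) (g : kar_hom Y Z) (f f' : kar_hom X Y) :
  kar_comp g (kar_add f f') = kar_add (kar_comp g f) (kar_comp g f').
Proof. by apply: kar_eq; rewrite /= compmD. Qed.

Definition karoubi : preadditive :=
  @Preadditive kar_category kar_add kar_zero kar_opp kar_addA kar_addC kar_add0
    kar_addN kar_comp_addl kar_comp_addr.

Definition kar_incl_ob (X : A) : karoubi := @KarOb X (idm X) (comp1m (idm X)).

Definition kar_incl_map (X Y : A) (f : hom X Y) :
    @hom karoubi (kar_incl_ob X) (kar_incl_ob Y) :=
  exist _ f (conj (comp1m f) (compm1 f)).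

Lemma kar_incl_map1 X : kar_incl_map (idm X) = idm (kar_incl_ob X).
Proof. exact: kar_eq. Qed.

Lemma kar_incl_mapM (X Y Z : A) (g : hom Y Z) (f : hom X Y) :
  kar_incl_map (g \oc f) = kar_incl_map g \oc kar_incl_map f.
Proof. exact: kar_eq. Qed.

Lemma kar_incl_mapD (X Y : A) (f g : hom X Y) :
  kar_incl_map (f + g) = kar_incl_map f + kar_incl_map g.
Proof. exact: kar_eq. Qed.

Definition kar_incl : additive_functor A karoubi :=
  @AdditiveFunctor A karoubi
    (@Functor A karoubi kar_incl_ob kar_incl_map kar_incl_map1 kar_incl_mapM)
    kar_incl_mapD.

Lemma karoubi_complete : idempotent_complete karoubi.
Proof.
move=> X e /(congr1 sval) /=; case: e => e [e1 e2] /= ee.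
have kk : (kar_idem X - e) \oc (kar_idem X - e) = kar_idem X - e.
  by rewrite compBm !compmB kar_idemK e1 e2 ee subrr subr0.
pose K : karoubi := KarOb kk.
have kP : @kar_homP K X (kar_idem X - e).
  by split; rewrite //= compmB kar_idemK e1.
exists K, (exist _ _ kP); split.
  by apply: kar_eq; rewrite /= compmB e2 ee subrr.
move=> Z [g [g1 g2]] /(congr1 sval) /= eg.
have gP : @kar_homP Z K g by split; rewrite //= compBm g1 eg subr0.
exists (exist _ g gP); split; first by apply: kar_eq; exact: gP.1.
move=> [h hP] /(congr1 sval) /= hg; apply: kar_eq => /=.
by rewrite -hg; exact: hP.1.
Qed.

Section Extend.
Variables (D : preadditive) (hD : idempotent_complete D).
Variable G : additive_functor A D.

Lemma kar_split_subproof (X : karoubi) :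
  let q := idm (G X) - fmap G (kar_idem X) in q \oc q = q.
Proof.
rewrite /= compBm !compmB !comp1m compm1 -fmapM kar_idemK.
by rewrite subrr subr0.
Qed.

Definition kar_split (X : karoubi) : kernel_of (idm (G X) - fmap G (kar_idem X)) :=
  choose_kernel (hD (kar_split_subproof X)).

Let i (X : karoubi) : hom (kar_split X) (G X) := ker_map (kar_split X).

Lemma kar_split_idem X : fmap G (kar_idem X) \oc i X = i X.
Proof.
have /eqP := ker_map0 (kar_split X).
by rewrite compBm comp1m subr_eq0 => /eqP <-.
Qed.

Lemma kar_ext_subproof (X Y : karoubi) (f : hom X Y) :
  (idm (G Y) - fmap G (kar_idem Y)) \oc (fmap G (sval f) \oc i X) = 0.
Proof.
case: f => f [f1 f2] /=.
by rewrite compBm comp1m compmA -fmapM f1 subrr.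
Qed.

Definition kar_ext_map (X Y : karoubi) (f : hom X Y) :
    hom (kar_split X) (kar_split Y) :=
  ker_lift (kar_split Y) (kar_ext_subproof f).

Lemma kar_ext_mapE (X Y : karoubi) (f : hom X Y) :
  i Y \oc kar_ext_map f = fmap G (sval f) \oc i X.
Proof. exact: ker_liftE. Qed.

Lemma kar_i_inj X : monic_hom (i X). Proof. exact: ker_map_inj. Qed.

Lemma kar_ext_map1 (X : karoubi) : kar_ext_map (idm X) = idm _.
Proof. by apply: kar_i_inj; rewrite kar_ext_mapE /= kar_split_idem compm1. Qed.

Lemma kar_ext_mapM (X Y Z : karoubi) (g : hom Y Z) (f : hom X Y) :
  kar_ext_map (g \oc f) = kar_ext_map g \oc kar_ext_map f.
Proof.
apply: kar_i_inj; rewrite compmA !kar_ext_mapE -compmA kar_ext_mapE.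
by rewrite compmA -fmapM.
Qed.

Lemma kar_ext_mapD (X Y : karoubi) (f g : hom X Y) :
  kar_ext_map (f + g) = kar_ext_map f + kar_ext_map g.
Proof.
apply: kar_i_inj; rewrite compmD !kar_ext_mapE -compDm -afunD.
by [].
Qed.

Definition kar_ext : additive_functor karoubi D :=
  @AdditiveFunctor karoubi D
    (@Functor karoubi D kar_split kar_ext_map kar_ext_map1 kar_ext_mapM)
    kar_ext_mapD.

Lemma kar_ext_incl : nat_iso (compF kar_ext kar_incl) G.
Proof.
exists (fun X : A => i (kar_incl X)); split=> [X|X Y f]; last first.
  by rewrite kar_ext_mapE.
have e0 : (idm (G X) - fmap G (kar_idem (kar_incl X))) \oc idm (G X) = 0.
  by rewrite /= fmap1 subrr comp0m.
exists (ker_lift (kar_split (kar_incl X)) e0); split; last exact: ker_liftE.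
by apply: kar_i_inj; rewrite compmA ker_liftE comp1m compm1.
Qed.

End Extend.

Lemma kar_unique (D : preadditive) (G G' : additive_functor karoubi D) :
  nat_iso (compF G kar_incl) (compF G' kar_incl) -> nat_iso G G'.
Proof.
move=> [t [tI tN]].
have rP (X : karoubi) : @kar_homP (kar_incl X) X (kar_idem X).
  by split; rewrite /= ?kar_idemK ?compm1.
have sP (X : karoubi) : @kar_homP X (kar_incl X) (kar_idem X).
  by split; rewrite /= ?kar_idemK ?comp1m.
pose r (X : karoubi) : hom (kar_incl X) X := exist _ _ (rP X).
pose s (X : karoubi) : hom X (kar_incl X) := exist _ _ (sP X).
have rs X : r X \oc s X = idm X by apply: kar_eq; exact: (kar_idemK X).
have sr X : s X \oc r X = fmap kar_incl (kar_idem X).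
  by apply: kar_eq; exact: (kar_idemK X).
exists (fun X => fmap G' (r X) \oc t X \oc fmap G (s X)); split; last first.
  move=> X Y f.
  have fr : f \oc r X = r Y \oc fmap kar_incl (sval f).
    by apply: kar_eq; rewrite /= (svalP f).1 (svalP f).2.
  have sf : fmap kar_incl (sval f) \oc s X = s Y \oc f.
    by apply: kar_eq; rewrite /= (svalP f).1 (svalP f).2.
  rewrite !compmA -fmapM fr fmapM -(compmA _ _ (t X)).
  have /= -> := tN _ _ (sval f).
  by rewrite !compmA -[in LHS]compmA -[in RHS]compmA -!fmapM sf.
move=> X; have [t' [t't tt']] := tI X.
exists (fmap G (r X) \oc t' \oc fmap G' (s X)).
have tX : fmap G' (s X) \oc fmap G' (r X) \oc t X =
          t X \oc (fmap G (s X) \oc fmap G (r X)).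
  by rewrite -!fmapM sr; exact: tN.
have e1 : t' \oc (fmap G' (s X) \oc fmap G' (r X)) \oc t X =
          fmap G (s X) \oc fmap G (r X).
  by rewrite -compmA tX compmA t't comp1m.
have e2 : t X \oc (fmap G (s X) \oc fmap G (r X)) \oc t' =
          fmap G' (s X) \oc fmap G' (r X).
  by rewrite -tX -!compmA tt' compm1.
split.
  transitivity (fmap G (r X) \oc
    (t' \oc (fmap G' (s X) \oc fmap G' (r X)) \oc t X) \oc fmap G (s X)).
    by rewrite !compmA.
  by rewrite e1 !compmA -fmapM rs fmap1 comp1m -fmapM rs fmap1.
transitivity (fmap G' (r X) \oc
  (t X \oc (fmap G (s X) \oc fmap G (r X)) \oc t') \oc fmap G' (s X)).
  by rewrite !compmA.
by rewrite e2 !compmA -fmapM rs fmap1 comp1m -fmapM rs fmap1.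
Qed.

Lemma karoubi_completion : idempotent_completion kar_incl.
Proof.
split.
- by move=> X Y [g gP]; exists g; exact: kar_eq.
- by move=> X Y f g /(congr1 sval).
- exact: karoubi_complete.
- by move=> D G hD; exists (kar_ext hD G); exact: kar_ext_incl.
- by move=> D G G' _; exact: kar_unique.
Qed.

End Karoubi.

Record abelian := Abelian {
  abase :> preadditive;
  has_zero_object : exists Z : abase, is_zero_object Z;
  has_products : forall X Y : abase,
    exists (Z : abase) (p : hom Z X) (q : hom Z Y), is_product p q;
  has_kernels : forall (X Y : abase) (f : hom X Y),
    exists (K : abase) (k : hom K X), is_kernel f k;
  has_cokernels : forall (X Y : abase) (f : hom X Y),
    exists (K : abase) (k : hom Y K), is_cokernel f k;
  monic_normal : forall (X Y : abase) (f : hom X Y), monic_hom f ->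
    exists (Z : abase) (g : hom Y Z), is_kernel g f;
  epic_normal : forall (X Y : abase) (f : hom X Y), epic_hom f ->
    exists (Z : abase) (g : hom Z X), is_cokernel g f
}.

Lemma abelian_idempotent_complete (B : abelian) : idempotent_complete B.
Proof. by move=> E p _; exact: has_kernels. Qed.

Arguments abelian_idempotent_complete B : clear implicits.

Record chain_complex (A : preadditive) := ChainComplex {
  chain_ob :> nat -> A;
  chain_diff : forall n, hom (chain_ob n.+1) (chain_ob n);
  diffK : forall n, chain_diff n \oc chain_diff n.+1 = 0
}.

Arguments chain_diff {A} K n : rename.

Record chain_map (A : preadditive) (K L : chain_complex A) := ChainMap {
  chain_mor :> forall n, hom (K n) (L n);
  chain_morP : forall n,
    chain_diff L n \oc chain_mor n.+1 = chain_mor n \oc chain_diff K n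
}.

Lemma map_diffK (A B : preadditive) (G : additive_functor A B)
    (K : chain_complex A) n :
  fmap G (chain_diff K n) \oc fmap G (chain_diff K n.+1) = 0.
Proof. by rewrite -fmapM diffK afun0. Qed.

Definition map_complex (A B : preadditive) (G : additive_functor A B)
    (K : chain_complex A) : chain_complex B :=
  @ChainComplex B (fun n => G (K n)) (fun n => fmap G (chain_diff K n))
    (map_diffK G K).

Lemma map_chain_subproof (A B : preadditive) (G : additive_functor A B)
    (K L : chain_complex A) (u : chain_map K L) n :
  fmap G (chain_diff L n) \oc fmap G (u n.+1) = fmap G (u n) \oc fmap G (chain_diff K n).
Proof. by rewrite -!fmapM chain_morP. Qed.

Definition map_chain (A B : preadditive) (G : additive_functor A B)
    (K L : chain_complex A) (u : chain_map K L) :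
    chain_map (map_complex G K) (map_complex G L) :=
  @ChainMap B (map_complex G K) (map_complex G L) (fun n => fmap G (u n))
    (map_chain_subproof G u).

Section Homology.
Variable B : abelian.
Implicit Types K L M : chain_complex B.

(* the differential going out of degree n, with K_(-1) = 0 encoded by the
   zero endomorphism of K_0 *)
Definition diff_out K n : hom (K n) (K n.-1) :=
  match n with 0 => 0 | m.+1 => chain_diff K m end.

Lemma diff_outK K n : diff_out K n \oc chain_diff K n = 0.
Proof. by case: n => [|n] /=; rewrite ?comp0m ?diffK. Qed.

Definition cycles K n : kernel_of (diff_out K n) :=
  choose_kernel (has_kernels (diff_out K n)).

Definition homology K n : cokernel_of (ker_lift (cycles K n) (diff_outK K n)) :=
  choose_cokernel (has_cokernels (ker_lift (cycles K n) (diff_outK K n))).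

Lemma diff_out_nat K L (u : chain_map K L) n :
  diff_out L n \oc u n = u n.-1 \oc diff_out K n.
Proof. by case: n => [|n] /=; rewrite ?comp0m ?compm0 ?chain_morP. Qed.

Lemma cycles_map_subproof K L (u : chain_map K L) n :
  diff_out L n \oc (u n \oc ker_map (cycles K n)) = 0.
Proof. by rewrite compmA diff_out_nat -compmA ker_map0 compm0. Qed.

Definition cycles_map K L (u : chain_map K L) n :
    hom (cycles K n) (cycles L n) :=
  ker_lift (cycles L n) (cycles_map_subproof u n).

Lemma homology_map_subproof K L (u : chain_map K L) n :
  (coker_map (homology L n) \oc cycles_map u n) \oc
    ker_lift (cycles K n) (diff_outK K n) = 0.
Proof.
rewrite -compmA.
have -> : cycles_map u n \oc ker_lift (cycles K n) (diff_outK K n) =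
          ker_lift (cycles L n) (diff_outK L n) \oc u n.+1.
  apply: (@ker_map_inj _ _ _ _ (cycles L n)).
  by rewrite !compmA !ker_liftE -compmA ker_liftE chain_morP.
by rewrite compmA coker_map0 comp0m.
Qed.

Definition homology_map K L (u : chain_map K L) n :
    hom (homology K n) (homology L n) :=
  coker_lift (homology K n) (homology_map_subproof u n).

Lemma homology_map1 K (u : chain_map K K) n :
  (forall m, u m = idm (K m)) -> homology_map u n = idm (homology K n).
Proof.
move=> u1; apply: (@coker_map_inj _ _ _ _ (homology K n)).
rewrite coker_liftE comp1m -[RHS]compm1; congr (_ \oc _).
apply: (@ker_map_inj _ _ _ _ (cycles K n)).
by rewrite ker_liftE u1 comp1m compm1.
Qed.

Lemma homology_mapM K L M (u : chain_map K L) (v : chain_map L M)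
    (w : chain_map K M) n :
  (forall m, w m = v m \oc u m) ->
  homology_map w n = homology_map v n \oc homology_map u n.
Proof.
move=> wE; apply: (@coker_map_inj _ _ _ _ (homology K n)).
rewrite -compmA !coker_liftE compmA coker_liftE -compmA; congr (_ \oc _).
apply: (@ker_map_inj _ _ _ _ (cycles M n)).
by rewrite compmA !ker_liftE -compmA ker_liftE wE compmA.
Qed.

End Homology.

Definition chain_homotopic (A : preadditive) (K L : chain_complex A)
    (u v : chain_map K L) : Prop :=
  exists h : forall n, hom (K n) (L n.+1),
    u 0 - v 0 = chain_diff L 0 \oc h 0 /\
    forall n, u n.+1 - v n.+1 = chain_diff L n.+1 \oc h n.+1 + h n \oc chain_diff K n.

Lemma homology_map_homotopic (B : abelian) (K L : chain_complex B)
    (u v : chain_map K L) n :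
  chain_homotopic u v -> homology_map u n = homology_map v n.
Proof.
move=> [h [h0 hS]]; apply: (@coker_map_inj _ _ _ _ (homology K n)).
rewrite !coker_liftE; apply/eqP; rewrite -subr_eq0 -compmB; apply/eqP.
suff -> : cycles_map u n - cycles_map v n =
    ker_lift (cycles L n) (diff_outK L n) \oc (h n \oc ker_map (cycles K n)).
  by rewrite compmA coker_map0 comp0m.
apply: (@ker_map_inj _ _ _ _ (cycles L n)).
rewrite compmB compmA !ker_liftE -compBm.
have := ker_map0 (cycles K n); case: n => [|n] /= z0.
  by rewrite h0 compmA.
by rewrite hS compDm -!compmA z0 compm0 addr0.
Qed.

Lemma map_chain_homotopic (A B : preadditive) (G : additive_functor A B)
    (K L : chain_complex A) (u v : chain_map K L) :
  chain_homotopic u v -> chain_homotopic (map_chain G u) (map_chain G v).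
Proof.
have GB (X Y : A) (f g : hom X Y) : fmap G f - fmap G g = fmap G (f - g).
  by apply/eqP; rewrite subr_eq -afunD subrK.
move=> [h [h0 hS]]; exists (fun n => fmap G (h n)); split=> /= [|n].
  by rewrite GB h0 fmapM.
by rewrite GB hS afunD !fmapM.
Qed.

Lemma rec_choice (T : nat -> Type) (I : forall n, T n -> Prop)
    (R : forall n, T n -> T n.+1 -> Prop) (x0 : T 0) :
  I 0 x0 -> (forall n x, I n x -> exists2 y, R n x y & I n.+1 y) ->
  exists x : forall n, T n,
    [/\ x 0 = x0, forall n, I n (x n) & forall n, R n (x n) (x n.+1)].
Proof.
move=> I0 step.
have stepS n (x : {x : T n | I n x}) :
    {y : {y : T n.+1 | I n.+1 y} | R n (sval x) (sval y)}.
  by case: x => x Ix; apply: cid; have [y Rxy Iy] := step n x Ix; exists (exist _ y Iy).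
pose s := nat_rect (fun n => {x : T n | I n x}) (exist _ x0 I0)
  (fun n x => sval (stepS n x)).
exists (fun n => sval (s n)); split=> // n; first exact: (svalP (s n)).
exact: (svalP (stepS n (s n))).
Qed.

Definition class_epi (C : category) (P : set C) (X Y : C) (f : hom X Y) : Prop :=
  forall Q, P Q -> forall y : hom Q Y, exists x : hom Q X, f \oc x = y.

Definition projective_class (C : category) (P : set C) : Prop :=
  forall X : C, exists Q : C, P Q /\ exists f : hom Q X, class_epi P f.

(* exactness of Hom(Q,X) -> Hom(Q,Y) -> Hom(Q,Z) *)
Definition hom_exact (A : preadditive) (Q X Y Z : A) (f : hom X Y)
    (g : hom Y Z) : Prop :=
  forall y : hom Q Y, g \oc y = 0 <-> exists x : hom Q X, f \oc x = y.

Definition class_exact (A : preadditive) (P : set A) (X Y Z : A)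
    (f : hom X Y) (g : hom Y Z) : Prop :=
  g \oc f = 0 /\ forall Q, P Q -> hom_exact Q f g.

Definition class_closure (A : preadditive) (P : set A) : set A :=
  [set Q | forall (X Y Z : A) (f : hom X Y) (g : hom Y Z),
     class_exact P f g -> hom_exact Q f g].

Definition is_resolution (A : preadditive) (P : set A) (X : A)
    (K : chain_complex A) (e : hom (K 0) X) : Prop :=
  [/\ e \oc chain_diff K 0 = 0,
      forall n, P (K n) &
      forall Q, P Q ->
        [/\ forall y : hom Q X, exists x : hom Q (K 0), e \oc x = y,
            hom_exact Q (chain_diff K 0) e &
            forall n, hom_exact Q (chain_diff K n.+1) (chain_diff K n)]].

Record resolution (A : preadditive) (P : set A) (X : A) := Resolution {
  res_complex :> chain_complex A;
  res_aug : hom (res_complex 0) X;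
  res_resolution : is_resolution P res_aug
}.

Section Comparison.
Variables (A : preadditive) (P : set A).

Lemma resolution_lift (X Y : A) (K : resolution P X) (L : resolution P Y)
    (f : hom X Y) :
  exists u : chain_map K L, res_aug L \oc u 0 = f \oc res_aug K.
Proof.
case: K L => K eK [eK0 PK _] [L eL [_ _ acL]] /=.
have [u0 u0P] : exists u0 : hom (K 0) (L 0), eL \oc u0 = f \oc eK.
  by case: (acL _ (PK 0)).
pose T n := hom (K n) (L n).
pose I n : T n -> Prop := match n with
  | 0 => fun v => eL \oc (v \oc chain_diff K 0) = 0
  | m.+1 => fun v => chain_diff L m \oc (v \oc chain_diff K m.+1) = 0 end.
pose R n (v : T n) (w : T n.+1) := chain_diff L n \oc w = v \oc chain_diff K n.
have I0 : I 0 u0 by rewrite /I /= compmA u0P -compmA eK0 compm0.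
have [|u [u0E _ uR]] := @rec_choice T I R u0 I0.
  move=> n v Iv; have [w wE] : exists w, R n v w.
    have [_ ex0 exS] := acL _ (PK n.+1).
    by case: n v Iv ex0 exS => [|n] v Iv ex0 exS; [apply/ex0|apply/exS].
  exists w => //=; rewrite compmA wE -compmA diffK compm0 //.
by exists (ChainMap uR); rewrite /= u0E.
Qed.

Lemma resolution_homotopic (X Y : A) (K : resolution P X) (L : resolution P Y)
    (u v : chain_map K L) :
  res_aug L \oc u 0 = res_aug L \oc v 0 -> chain_homotopic u v.
Proof.
case: K L u v => K eK [eK0 PK _] [L eL [_ _ acL]] /= u v uv0.
have [h0 h0P] : exists h0 : hom (K 0) (L 1), chain_diff L 0 \oc h0 = u 0 - v 0.
  by case: (acL _ (PK 0)) => _ ex0 _; apply/ex0; rewrite compmB uv0 subrr.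
pose T n := hom (K n) (L n.+1).
pose I n (h : T n) := chain_diff L n \oc (u n.+1 - v n.+1 - h \oc chain_diff K n) = 0.
pose R n (h : T n) (k : T n.+1) :=
  u n.+1 - v n.+1 = chain_diff L n.+1 \oc k + h \oc chain_diff K n.
have I0 : I 0 h0.
  by rewrite /I compmB compmB !chain_morP compmA h0P compBm subrr.
have [|h [h0E _ hR]] := @rec_choice T I R h0 I0.
  move=> n h Ih; have [k kE] : exists k, chain_diff L n.+1 \oc k = u n.+1 - v n.+1 - h \oc chain_diff K n.
    by have [_ _ exS] := acL _ (PK n.+1); apply/exS.
  exists k; first by rewrite /R kE subrK.
  by rewrite /I compmB compmB !chain_morP compmA kE !compBm -!compmA diffK compm0 subr0 subrr.
exists h; split=> [|n]; last exact: hR.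
by rewrite h0E h0P.
Qed.

End Comparison.

Section EilenbergMoore.
Variables (A : preadditive) (P : set A) (B : abelian).
Variable G : additive_functor A B.
Variable R : forall X : A, resolution P X.

Definition res_map (X Y : A) (f : hom X Y) : chain_map (R X) (R Y) :=
  projT1 (cid (resolution_lift (R X) (R Y) f)).

Lemma res_mapP (X Y : A) (f : hom X Y) :
  res_aug (R Y) \oc res_map f 0 = f \oc res_aug (R X).
Proof. by rewrite /res_map; case: cid. Qed.

Definition left_derived_map n (X Y : A) (f : hom X Y) :
    hom (homology (map_complex G (R X)) n) (homology (map_complex G (R Y)) n) :=
  homology_map (map_chain G (res_map f)) n.

(* the value on f does not depend on the chosen lift of f *)
Lemma left_derived_mapE n (X Y : A) (f : hom X Y) (u : chain_map (R X) (R Y)) :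
  res_aug (R Y) \oc u 0 = f \oc res_aug (R X) ->
  left_derived_map n f = homology_map (map_chain G u) n.
Proof.
move=> uP; apply: homology_map_homotopic; apply: map_chain_homotopic.
by apply: resolution_homotopic; rewrite uP res_mapP.
Qed.

Lemma left_derived_map1 n X : left_derived_map n (idm X) = idm _.
Proof.
have c n' : chain_diff (R X) n' \oc idm _ = idm _ \oc chain_diff (R X) n'.
  by rewrite comp1m compm1.
rewrite (@left_derived_mapE n X X (idm X) (ChainMap c)) /= ?comp1m ?compm1 //.
by apply: homology_map1 => m /=; rewrite fmap1.
Qed.

Lemma left_derived_mapM n (X Y Z : A) (g : hom Y Z) (f : hom X Y) :
  left_derived_map n (g \oc f) = left_derived_map n g \oc left_derived_map n f.
Proof.
have c m : chain_diff (R Z) m \oc (res_map g m.+1 \oc res_map f m.+1) =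
           (res_map g m \oc res_map f m) \oc chain_diff (R X) m.
  by rewrite compmA chain_morP -!compmA chain_morP.
rewrite (@left_derived_mapE n X Z _ (ChainMap c)) /=.
  by apply: homology_mapM => m /=; rewrite fmapM.
by rewrite compmA res_mapP -!compmA res_mapP.
Qed.

(* L^P_n G, computed with the chosen resolutions R *)
Definition left_derived n : functor A B :=
  @Functor A B (fun X => homology (map_complex G (R X)) n)
    (left_derived_map n) (left_derived_map1 n) (@left_derived_mapM n).

End EilenbergMoore.

(* Faces and pseudodegeneracies are numbered from 1 as usual; for n : nat and
   1 <= i <= n.+1, [face X n a i] : X_(n+1) -> X_n is d_i^a (with a = true, false
   for a = 1, 0) and [pdeg X n i] : X_n -> X_(n+1) is s_i.  The values at other
   indices i are irrelevant. *)
Record pseudocubical (C : category) := Pseudocubical {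
  pc_ob :> nat -> C;
  face : forall n, bool -> nat -> hom (pc_ob n.+1) (pc_ob n);
  pdeg : forall n, nat -> hom (pc_ob n) (pc_ob n.+1);
  face_face : forall n (a e : bool) i j, (0 < i)%N -> (i < j)%N -> (j <= n.+2)%N ->
    face n a i \oc face n.+1 e j = face n e j.-1 \oc face n.+1 a i;
  face_pdeg_lt : forall n (a : bool) i j, (0 < i)%N -> (i < j)%N -> (j <= n.+2)%N ->
    face n.+1 a i \oc pdeg n.+1 j = pdeg n j.-1 \oc face n a i;
  face_pdeg_id : forall n (a : bool) i, (0 < i)%N -> (i <= n.+1)%N ->
    face n a i \oc pdeg n i = idm (pc_ob n);
  face_pdeg_gt : forall n (a : bool) i j, (0 < j)%N -> (j < i)%N -> (i <= n.+2)%N ->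
    face n.+1 a i \oc pdeg n.+1 j = pdeg n j \oc face n a i.-1
}.

Arguments face {C} X n a i : rename.
Arguments pdeg {C} X n i : rename.

Definition is_augmentation (C : category) (X : pseudocubical C) (c : C)
    (e : hom (X 0) c) : Prop :=
  e \oc face X 0 false 1 = e \oc face X 0 true 1.

Definition aug_class_exact (C : category) (P : set C) (X : pseudocubical C)
    (c : C) (e : hom (X 0) c) : Prop :=
  forall Q, P Q ->
  [/\ forall y : hom Q c, exists x : hom Q (X 0), e \oc x = y,
      forall x y : hom Q (X 0), e \oc x = e \oc y ->
        exists z : hom Q (X 1), face X 0 false 1 \oc z = x /\
                                face X 0 true 1 \oc z = y &
      forall n (x : nat -> bool -> hom Q (X n.+1)),
        (forall i j (a e' : bool), (0 < i)%N -> (i < j)%N -> (j <= n.+2)%N ->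
           face X n a i \oc x j e' = face X n e' j.-1 \oc x i a) ->
        exists z : hom Q (X n.+2), forall i (e' : bool), (0 < i)%N -> (i <= n.+2)%N ->
          face X n.+1 e' i \oc z = x i e'].

Record cubical_resolution (C : category) (P : set C) (c : C) :=
  CubicalResolution {
    cub_ob :> pseudocubical C;
    cub_aug : hom (cub_ob 0) c;
    cub_augP : is_augmentation cub_aug;
    cub_proj : forall n, P (cub_ob n);
    cub_exact : aug_class_exact P cub_aug
  }.

Section MapPseudocubical.
Variables (C D : category) (F : functor C D) (X : pseudocubical C).

Lemma map_face_face n (a e : bool) i j : (0 < i)%N -> (i < j)%N -> (j <= n.+2)%N ->
  fmap F (face X n a i) \oc fmap F (face X n.+1 e j) =
  fmap F (face X n e j.-1) \oc fmap F (face X n.+1 a i).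
Proof. by move=> *; rewrite -!fmapM face_face. Qed.

Lemma map_face_pdeg_lt n (a : bool) i j : (0 < i)%N -> (i < j)%N -> (j <= n.+2)%N ->
  fmap F (face X n.+1 a i) \oc fmap F (pdeg X n.+1 j) =
  fmap F (pdeg X n j.-1) \oc fmap F (face X n a i).
Proof. by move=> *; rewrite -!fmapM face_pdeg_lt. Qed.

Lemma map_face_pdeg_id n (a : bool) i : (0 < i)%N -> (i <= n.+1)%N ->
  fmap F (face X n a i) \oc fmap F (pdeg X n i) = idm (F (X n)).
Proof. by move=> *; rewrite -!fmapM face_pdeg_id ?fmap1. Qed.

Lemma map_face_pdeg_gt n (a : bool) i j : (0 < j)%N -> (j < i)%N -> (i <= n.+2)%N ->
  fmap F (face X n.+1 a i) \oc fmap F (pdeg X n.+1 j) =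
  fmap F (pdeg X n j) \oc fmap F (face X n a i.-1).
Proof. by move=> *; rewrite -!fmapM face_pdeg_gt. Qed.

Definition map_pseudocubical : pseudocubical D :=
  @Pseudocubical D (fun n => F (X n)) (fun n a i => fmap F (face X n a i))
    (fun n i => fmap F (pdeg X n i))
    map_face_face map_face_pdeg_lt map_face_pdeg_id map_face_pdeg_gt.

End MapPseudocubical.

Section Normalization.
Variable A : preadditive.

Lemma alternating_sum (V : zmodType) (E : nat -> nat -> V) n :
  (forall i j, (i < j)%N -> (j <= n)%N -> E i j = E j.-1 i) ->
  \sum_(0 <= i < n) \sum_(0 <= j < n.+1) E i j *~ (-1) ^+ (i + j) = 0.
Proof.
elim: n => [|n IH] EE; first by rewrite big_geq.
rewrite big_nat_recr //=.
have -> : \sum_(0 <= i < n) \sum_(0 <= j < n.+2) E i j *~ (-1) ^+ (i + j) =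
          \sum_(0 <= i < n) \sum_(0 <= j < n.+1) E i j *~ (-1) ^+ (i + j) +
          \sum_(0 <= i < n) E n i *~ (-1) ^+ (i + n.+1).
  rewrite -big_split; apply: eq_big_nat => i /andP[_ lin].
  by rewrite big_nat_recr //= [E i n.+1]EE // ltnW.
rewrite IH ?add0r; last by move=> i j lij ljn; apply: EE => //; exact: leqW.
rewrite big_nat_recr //= big_nat_recr //= [E n n.+1]EE //=.
rewrite -[X in _ + X]addrA [X in _ + (_ + X)](_ : _ = 0) ?addr0; last first.
  by rewrite addnS exprS mulN1r -mulrzDr addrN mulr0z.
rewrite -big_split big1_seq // => i _.
by rewrite /= addnS exprS mulN1r addnC -mulrzDr addNr mulr0z.
Qed.

Variable X : pseudocubical A.

Definition pc_boundary n : hom (X n.+1) (X n) :=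
  \sum_(1 <= i < n.+2) (face X n true i - face X n false i) *~ (-1) ^+ i.

Lemma boundaryK n : pc_boundary n \oc pc_boundary n.+1 = 0.
Proof.
rewrite /pc_boundary !big_add1 /= comp_suml.
pose d m i := face X m true i.+1 - face X m false i.+1.
rewrite -[RHS](@alternating_sum _ (fun i j => d n i \oc d n.+1 j) n.+1).
  apply: eq_bigr => i _; rewrite comp_sumr; apply: eq_bigr => j _.
  rewrite compzm compmz -mulrzA -exprD addSn addnS !exprS !mulN1r opprK.
  by rewrite addnC.
move=> i [|j] // lij ljn; rewrite /d /= !compBm !compmB.
have ff a e : face X n a i.+1 \oc face X n.+1 e j.+2 =
              face X n e j.+1 \oc face X n.+1 a i.+1 by rewrite face_face.
by rewrite !ff !opprB addrACA [- _ - _]addrC addrACA.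
Qed.

(* C(X) *)
Definition cubical_complex : chain_complex A :=
  @ChainComplex A X pc_boundary boundaryK.

(* sigma_n = (1 - s_1 d_1^1) (1 - s_2 d_2^1) ... (1 - s_n d_n^1) *)
Definition pc_sigma n : hom (X n) (X n) :=
  match n with
  | 0 => idm (X 0)
  | m.+1 => \big[(fun g f => g \oc f)/idm (X m.+1)]_(1 <= i < m.+2)
              (idm (X m.+1) - pdeg X m i \oc face X m true i)
  end.

Lemma face1_factor n i : (0 < i)%N -> (i <= n.+1)%N ->
  face X n true i \oc (idm _ - pdeg X n i \oc face X n true i) = 0.
Proof.
by move=> *; rewrite compmB compm1 compmA face_pdeg_id // comp1m subrr.
Qed.

Lemma face1_comm n i j : (0 < j)%N -> (j < i)%N -> (i <= n.+1)%N ->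
  exists g : hom (X n) (X n),
    face X n true i \oc (idm _ - pdeg X n j \oc face X n true j) =
    g \oc face X n true i.
Proof.
case: n => [|n] j0 ji iN; first by have := leq_trans (leq_ltn_trans j0 ji) iN.
exists (idm _ - pdeg X n j \oc face X n true j).
rewrite compmB compBm compm1 comp1m !compmA face_pdeg_gt //.
by rewrite -!compmA (@face_face _ X n true true j i).
Qed.

Lemma face1_sigma n i : (0 < i)%N -> (i <= n.+1)%N ->
  face X n true i \oc pc_sigma n.+1 = 0.
Proof.
move=> i0 iN.
suff H k j : (0 < j)%N -> (j + k)%N = i ->
    face X n true i \oc \big[(fun g f => g \oc f)/idm (X n.+1)]_(j <= i < n.+2)
              (idm (X n.+1) - pdeg X n i \oc face X n true i) = 0.
  by apply: (H i.-1 1%N) => //; rewrite add1n prednK.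
elim: k j => [|k IH] j j0.
  by rewrite addn0 => ji; rewrite ji big_ltn // compmA face1_factor // comp0m.
rewrite addnS -addSn => jki; have ji : (j < i)%N by rewrite -jki leq_addr.
rewrite big_ltn; last exact: leq_trans ji (leqW iN).
have [g gE] := face1_comm j0 ji iN.
by rewrite compmA gE -compmA IH // compm0.
Qed.

Definition pc_normal (Q : A) n : hom Q (X n) -> Prop :=
  match n with
  | 0 => fun _ => True
  | m.+1 => fun x => forall i, (0 < i)%N -> (i <= m.+1)%N ->
                       face X m true i \oc x = 0
  end.

Lemma normalP (Q : A) n (x : hom Q (X n)) :
  pc_normal x <-> (idm (X n) - pc_sigma n) \oc x = 0.
Proof.
case: n x => [|n] x; first by rewrite /= subrr comp0m.
rewrite compBm comp1m; split=> [x0|/eqP]; last first.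
  rewrite subr_eq0 => /eqP -> i i0 iN.
  by rewrite compmA face1_sigma // comp0m.
apply/eqP; rewrite subr_eq0; apply/eqP => /=.
suff: forall r : seq nat, (forall i, i \in r -> (0 < i <= n.+1)%N) ->
   x = \big[(fun g f => g \oc f)/idm (X n.+1)]_(i <- r)
              (idm (X n.+1) - pdeg X n i \oc face X n true i) \oc x.
  by apply=> i; rewrite mem_index_iota ltnS.
elim=> [|i r IH] rP; first by rewrite big_nil comp1m.
rewrite big_cons -compmA -IH; last by move=> k kr; apply: rP; rewrite inE kr orbT.
have /andP[i0 iN] : (0 < i <= n.+1)%N by apply: rP; rewrite inE eqxx.
by rewrite compBm comp1m -compmA x0 // compm0 subr0.
Qed.

Lemma sigma_normal n : pc_normal (pc_sigma n).
Proof. by case: n => [|n] //= i i0 iN; exact: face1_sigma. Qed.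

Lemma sigmaK n : pc_sigma n \oc pc_sigma n = pc_sigma n.
Proof.
have /normalP := sigma_normal n; rewrite compBm comp1m => /eqP.
by rewrite subr_eq0 => /eqP <-.
Qed.

Lemma one_sigmaK n :
  (idm (X n) - pc_sigma n) \oc (idm (X n) - pc_sigma n) = idm (X n) - pc_sigma n.
Proof. by rewrite compBm !compmB !comp1m compm1 sigmaK subrr subr0. Qed.

Lemma boundary_normal (Q : A) n (x : hom Q (X n.+1)) :
  pc_normal x -> pc_normal (pc_boundary n \oc x).
Proof.
case: n x => [|n] x //= x0 i i0 iN.
rewrite compmA comp_sumr comp_suml big_seq big1 // => j.
rewrite mem_index_iota => /andP[j0 jN].
have [lij|lji] := ltnP i j.
  have e b : face X n true i \oc face X n.+1 b j \oc x = 0.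
    by rewrite face_face // -compmA x0 ?compm0 //; exact: leqW.
  by rewrite compmz compzm compmB compBm !e subrr mul0rz.
have e b : face X n true i \oc face X n.+1 b j \oc x = 0.
  have -> : face X n true i \oc face X n.+1 b j =
            face X n b j \oc face X n.+1 true i.+1.
    by rewrite (@face_face _ X n b true j i.+1).
  by rewrite -compmA x0 // compm0.
by rewrite compmz compzm compmB compBm !e subrr mul0rz.
Qed.

Lemma boundary_normalE (Q : A) n (x : hom Q (X n.+1)) : pc_normal x ->
  pc_boundary n \oc x =
  - \sum_(1 <= i < n.+2) (face X n false i \oc x) *~ (-1) ^+ i.
Proof.
move=> x0; rewrite comp_suml -sumrN big_seq [RHS]big_seq; apply: eq_bigr => i.
rewrite mem_index_iota => /andP[i0 iN].
by rewrite compzm compBm (x0 i) // sub0r mulNrz.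
Qed.

Hypothesis hA : idempotent_complete A.

Definition normal_ker n : kernel_of (idm (X n) - pc_sigma n) :=
  choose_kernel (hA (one_sigmaK n)).

Lemma normal_ker_map n : pc_normal (ker_map (normal_ker n)).
Proof. by apply/normalP; exact: ker_map0. Qed.

Lemma normal_diff_subproof n :
  (idm (X n) - pc_sigma n) \oc (pc_boundary n \oc ker_map (normal_ker n.+1)) = 0.
Proof. by apply/normalP; apply: boundary_normal; exact: normal_ker_map. Qed.

Definition normal_diff n : hom (normal_ker n.+1) (normal_ker n) :=
  ker_lift (normal_ker n) (normal_diff_subproof n).

Lemma normal_diffK n : normal_diff n \oc normal_diff n.+1 = 0.
Proof.
apply: (@ker_map_inj _ _ _ _ (normal_ker n)).
by rewrite compmA ker_liftE -compmA ker_liftE compmA boundaryK comp0m compm0.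
Qed.

(* N(X), the degreewise kernel of 1 - sigma with the differential induced by
   that of C(X) *)
Definition normalized : chain_complex A :=
  @ChainComplex A normal_ker normal_diff normal_diffK.

(* the inclusion N(X) -> C(X) *)
Definition normal_incl n : hom (normalized n) (X n) := ker_map (normal_ker n).

Lemma normal_incl_normal n : pc_normal (normal_incl n).
Proof. exact: normal_ker_map. Qed.

Lemma normal_incl_inj n : monic_hom (normal_incl n).
Proof. exact: ker_map_inj. Qed.

Lemma normal_incl_diff n :
  normal_incl n \oc chain_diff normalized n = pc_boundary n \oc normal_incl n.+1.
Proof. exact: ker_liftE. Qed.

Definition normal_lift (Q : A) n (x : hom Q (X n)) (xN : pc_normal x) :
    hom Q (normalized n) :=
  ker_lift (normal_ker n) ((normalP x).1 xN).

Lemma normal_liftE (Q : A) n (x : hom Q (X n)) (xN : pc_normal x) :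
  normal_incl n \oc normal_lift xN = x.
Proof. exact: ker_liftE. Qed.

(* the augmentation N(X)_0 -> X_0 -> c; here N(X)_0 is the kernel of
   1 - sigma_0 = 0, so that N(X)_0 -> X_0 is an isomorphism *)
Definition normal_aug (c : A) (e : hom (X 0) c) : hom (normalized 0) c :=
  e \oc normal_incl 0.

End Normalization.

(* maps commuting with faces, but not necessarily with pseudodegeneracies *)
Record precubical_map (C : category) (X Y : pseudocubical C) := PrecubicalMap {
  pcm_mor :> forall n, hom (X n) (Y n);
  pcm_face : forall n (a : bool) i, (0 < i)%N -> (i <= n.+1)%N ->
    face Y n a i \oc pcm_mor n.+1 = pcm_mor n \oc face X n a i
}.

Lemma map_precubical_subproof (C D : category) (F : functor C D)
    (X Y : pseudocubical C) (u : precubical_map X Y) n (a : bool) i :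
  (0 < i)%N -> (i <= n.+1)%N ->
  fmap F (face Y n a i) \oc fmap F (u n.+1) =
  fmap F (u n) \oc fmap F (face X n a i).
Proof. by move=> *; rewrite -!fmapM pcm_face. Qed.

Definition map_precubical (C D : category) (F : functor C D)
    (X Y : pseudocubical C) (u : precubical_map X Y) :
    precubical_map (map_pseudocubical F X) (map_pseudocubical F Y) :=
  @PrecubicalMap D (map_pseudocubical F X) (map_pseudocubical F Y)
    (fun n => fmap F (u n)) (map_precubical_subproof F u).

Section NormalizedMap.
Variables (A : preadditive) (hA : idempotent_complete A).

Lemma normal_comp (X Y : pseudocubical A) (u : precubical_map X Y) (Q : A) n
    (x : hom Q (X n)) : pc_normal x -> pc_normal (u n \oc x).
Proof.
case: n x => [|n] x //= x0 i i0 iN.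
by rewrite compmA pcm_face // -compmA x0 // compm0.
Qed.

Definition normal_map (X Y : pseudocubical A) (u : precubical_map X Y) n :
    hom (normalized X hA n) (normalized Y hA n) :=
  normal_lift hA (normal_comp u (normal_incl_normal X hA n)).

Lemma boundary_nat (X Y : pseudocubical A) (u : precubical_map X Y) n :
  pc_boundary Y n \oc u n.+1 = u n \oc pc_boundary X n.
Proof.
rewrite comp_suml comp_sumr big_seq [RHS]big_seq; apply: eq_bigr => i.
rewrite mem_index_iota => /andP[i0 iN].
by rewrite compzm compmz compBm compmB !pcm_face.
Qed.

Lemma normal_map_chain (X Y : pseudocubical A) (u : precubical_map X Y) n :
  chain_diff (normalized Y hA) n \oc normal_map u n.+1 =
  normal_map u n \oc chain_diff (normalized X hA) n.
Proof.
apply: normal_incl_inj.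
rewrite !compmA normal_incl_diff normal_liftE -!compmA normal_liftE.
by rewrite normal_incl_diff !compmA boundary_nat.
Qed.

(* N(u) *)
Definition normalized_map (X Y : pseudocubical A) (u : precubical_map X Y) :
    chain_map (normalized X hA) (normalized Y hA) :=
  @ChainMap A (normalized X hA) (normalized Y hA) (normal_map u)
    (normal_map_chain u).

Lemma normal_incl_map (X Y : pseudocubical A) (u : precubical_map X Y) n :
  normal_incl Y hA n \oc normalized_map u n = u n \oc normal_incl X hA n.
Proof. exact: normal_liftE. Qed.

End NormalizedMap.

Definition precubical_homotopic (C : category) (X Y : pseudocubical C)
    (u v : precubical_map X Y) : Prop :=
  exists h : forall n, hom (X n) (Y n.+1),
    [/\ forall n, face Y n false 1 \oc h n = u n,
        forall n, face Y n true 1 \oc h n = v n &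
        forall n (a : bool) i, (0 < i)%N -> (i <= n.+1)%N ->
          face Y n.+1 a i.+1 \oc h n.+1 = h n \oc face X n a i].

Lemma map_precubical_homotopic (C D : category) (F : functor C D)
    (X Y : pseudocubical C) (u v : precubical_map X Y) :
  precubical_homotopic u v ->
  precubical_homotopic (map_precubical F u) (map_precubical F v).
Proof.
move=> [h [h0 h1 hS]]; exists (fun n => fmap F (h n)).
split=> [n|n|n a i i0 iN] /=; first by rewrite -fmapM h0.
  by rewrite -fmapM h1.
by rewrite -!fmapM hS.
Qed.

Lemma normalized_map_homotopic (A : preadditive) (hA : idempotent_complete A)
    (X Y : pseudocubical A) (u v : precubical_map X Y) :
  precubical_homotopic u v ->
  chain_homotopic (normalized_map hA u) (normalized_map hA v).
Proof.
move=> [h [h0 h1 hS]].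
pose k n : hom (X n) (Y n.+1) := h n - pdeg Y n 1 \oc v n.
have kN n : pc_normal (k n \oc normal_incl X hA n).
  move=> i i0 iN; have xN := normal_incl_normal X hA n.
  rewrite /k compmA compmB.
  case: i i0 iN => [|[|i]] // _ iN.
    by rewrite h1 compmA face_pdeg_id // comp1m subrr comp0m.
  case: n iN xN => [|n] iN xN //.
  rewrite hS // compmA face_pdeg_gt //= -compmA pcm_face // compBm -!compmA.
  by rewrite (xN i.+1) // !compm0 subrr.
pose g n := normal_lift hA (kN n).
have gE n : normal_incl Y hA n.+1 \oc g n = k n \oc normal_incl X hA n.
  exact: normal_liftE.
have k0 n : face Y n false 1 \oc k n = u n - v n.
  by rewrite compmB h0 compmA face_pdeg_id // comp1m.
have kS n i : (0 < i)%N -> (i <= n.+1)%N ->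
    face Y n.+1 false i.+1 \oc k n.+1 = k n \oc face X n false i.
  move=> i0 iN; rewrite compmB compBm hS // compmA face_pdeg_gt //=.
  by rewrite -!compmA pcm_face.
have dg n : normal_incl Y hA n \oc (chain_diff (normalized Y hA) n \oc g n) =
            pc_boundary Y n \oc (k n \oc normal_incl X hA n).
  by rewrite compmA normal_incl_diff -compmA gE.
have gd n : normal_incl Y hA n.+1 \oc (g n \oc chain_diff (normalized X hA) n) =
            k n \oc (pc_boundary X n \oc normal_incl X hA n.+1).
  by rewrite compmA gE -compmA normal_incl_diff.
exists g; split=> [|n]; apply: normal_incl_inj.
  rewrite compmB !normal_incl_map -compBm -k0 dg boundary_normalE //.
  by rewrite big_nat1 expr1 mulrNz opprK mulr1z compmA.
rewrite compmB compmD !normal_incl_map -compBm -k0 dg gd.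
rewrite boundary_normalE // boundary_normalE; last exact: normal_incl_normal.
rewrite big_ltn // expr1 mulrNz opprD opprK mulr1z compmA -[LHS]addr0 -addrA.
congr (_ + _); rewrite compmN comp_sumr -opprD big_add1 /=.
rewrite -big_split; apply/esym/eqP; rewrite oppr_eq0; apply/eqP/big1_seq => i /=.
rewrite mem_index_iota => /andP[i0 iN].
by rewrite compmA kS // compmz -compmA exprS mulN1r mulrNz addNr.
Qed.

Section CubicalComparison.
Variables (C : category) (P : set C).

Lemma cubical_lift (c d : C) (X : cubical_resolution P c)
    (Y : cubical_resolution P d) (f : hom c d) :
  exists u : precubical_map X Y, cub_aug Y \oc u 0 = f \oc cub_aug X.
Proof.
case: X Y => X eX XP PX _ [Y eY YP _ acY] /=.
have [u0 u0P] : exists u0 : hom (X 0) (Y 0), eY \oc u0 = f \oc eX.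
  by case: (acY _ (PX 0)).
pose T n := hom (X n) (Y n).
pose I n : T n -> Prop := match n with
  | 0 => fun w => eY \oc (w \oc face X 0 false 1) = eY \oc (w \oc face X 0 true 1)
  | m.+1 => fun w => forall i j (a e : bool), (0 < i)%N -> (i < j)%N -> (j <= m.+2)%N ->
       face Y m a i \oc (w \oc face X m.+1 e j) =
       face Y m e j.-1 \oc (w \oc face X m.+1 a i) end.
pose R n (w : T n) (w' : T n.+1) := forall (a : bool) i,
  (0 < i)%N -> (i <= n.+1)%N -> face Y n a i \oc w' = w \oc face X n a i.
have I0 : I 0 u0 by rewrite /I /= !compmA u0P -!compmA XP.
have [|u [u0E _ uR]] := @rec_choice T I R u0 I0.
  move=> n w Iw; have [w' wE] : exists w', R n w w'.
    have [_ ex1 exS] := acY _ (PX n.+1).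
    case: n w Iw ex1 exS => [|n] w Iw ex1 exS.
      have [z [z0 z1]] := ex1 _ _ Iw; exists z => a i.
      by case: i => [|[|i]] // _ _; case: a.
    have [z zP] := exS n (fun i a => w \oc face X n.+1 a i) Iw.
    by exists z => a i; exact: zP.
  exists w' => // i j a e i0 ij jN.
  have [j0 j1 iN] : [/\ (0 < j.-1)%N, (j.-1 <= n.+1)%N & (i <= n.+1)%N].
    case: j ij jN => // j; rewrite !ltnS => ij jN.
    by split; [exact: leq_trans ij| |exact: leq_trans jN].
  rewrite compmA (wE a i i0 iN) [RHS]compmA (wE e j.-1 j0 j1) -!compmA.
  by congr (_ \oc _); exact: face_face.
exists (@PrecubicalMap C X Y u (fun n a i => uR n a i)).
by rewrite /= u0E.
Qed.

Lemma cubical_homotopic (c d : C) (X : cubical_resolution P c)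
    (Y : cubical_resolution P d) (u v : precubical_map X Y) :
  cub_aug Y \oc u 0 = cub_aug Y \oc v 0 -> precubical_homotopic u v.
Proof.
case: X Y u v => X eX XP PX _ [Y eY YP _ acY] /= u v uv.
have [h0 [h00 h01]] : exists h0 : hom (X 0) (Y 1),
    face Y 0 false 1 \oc h0 = u 0 /\ face Y 0 true 1 \oc h0 = v 0.
  by have [_ ex1 _] := acY _ (PX 0); apply: ex1.
pose T n := hom (X n) (Y n.+1).
pose I n (h : T n) := [/\ face Y n false 1 \oc h = u n,
   face Y n true 1 \oc h = v n &
   forall i j (a e : bool), (1 < i)%N -> (i < j)%N -> (j <= n.+2)%N ->
     face Y n a i \oc (h \oc face X n e j.-1) =
     face Y n e j.-1 \oc (h \oc face X n a i.-1)].
pose R n (h : T n) (h' : T n.+1) := forall (a : bool) i,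
  (0 < i)%N -> (i <= n.+1)%N -> face Y n.+1 a i.+1 \oc h' = h \oc face X n a i.
have I0 : I 0 h0.
  by split=> // i j a e i1 ij jN; have := leq_trans (leq_ltn_trans i1 ij) jN.
have [|h [_ hI hR]] := @rec_choice T I R h0 I0; last first.
  exists h; split=> // n; by case: (hI n).
move=> n h [hu hv hh].
pose x i (a : bool) := if i == 1%N then (if a then v n.+1 else u n.+1)
                       else h \oc face X n a i.-1.
have [|z zP] := let: And3 _ _ exS := acY _ (PX n.+1) in exS n x.
  move=> i j a e i0 ij jN; rewrite /x.
  have -> : (j == 1%N) = false by apply/gtn_eqF/(leq_ltn_trans i0 ij).
  have [i1|i1] := eqVneq i 1%N.
    have jN' : (0 < j.-1 <= n.+1)%N.
      by case: j ij jN => [|j] //=; rewrite i1 ltnS => -> .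
    case/andP: jN' => j1 j2.
    by rewrite i1 compmA; case: a; rewrite ?hu ?hv pcm_face.
  by apply: hh => //; rewrite ltn_neqAle eq_sym i1.
exists z.
  move=> a i i0 iN; rewrite zP // /x /=.
  by case: i i0 iN.
split.
- by rewrite (zP 1%N false).
- by rewrite (zP 1%N true).
move=> i j a e i1 ij jN.
case: i i1 ij => [|i] // i1 ij; case: j ij jN => [|j] // ij jN /=.
rewrite ltnS in ij; rewrite ltnS in jN; rewrite ltnS in i1.
rewrite !compmA (zP i.+1 a) //; last exact: leq_trans ij jN.
rewrite (zP j e) //; last first.
  exact: leq_ltn_trans (leq0n _) ij.
rewrite /x eqSS gtn_eqF // gtn_eqF; last exact: leq_ltn_trans i1 ij.
rewrite /= -!compmA.
by congr (_ \oc _); exact: face_face.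
Qed.

End CubicalComparison.

Section CubicalDerived.
Variables (C : category) (P : set C) (B : abelian) (F : functor C B).
Variable X : forall c : C, cubical_resolution P c.

Let hB := abelian_idempotent_complete B.

Definition cub_map (c d : C) (f : hom c d) : precubical_map (X c) (X d) :=
  projT1 (cid (cubical_lift (X c) (X d) f)).

Lemma cub_mapP (c d : C) (f : hom c d) :
  cub_aug (X d) \oc cub_map f 0 = f \oc cub_aug (X c).
Proof. by rewrite /cub_map; case: cid. Qed.

Definition cubical_complex_of (c : C) : chain_complex B :=
  normalized (map_pseudocubical F (X c)) hB.

Definition cubical_derived_map n (c d : C) (f : hom c d) :
    hom (homology (cubical_complex_of c) n) (homology (cubical_complex_of d) n) :=
  homology_map (normalized_map hB (map_precubical F (cub_map f))) n.

(* the value on f does not depend on the chosen lift of f *)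
Lemma cubical_derived_mapE n (c d : C) (f : hom c d)
    (u : precubical_map (X c) (X d)) :
  cub_aug (X d) \oc u 0 = f \oc cub_aug (X c) ->
  cubical_derived_map n f =
  homology_map (normalized_map hB (map_precubical F u)) n.
Proof.
move=> uP; apply: homology_map_homotopic; apply: normalized_map_homotopic.
apply: map_precubical_homotopic; apply: cubical_homotopic.
by rewrite uP cub_mapP.
Qed.

Lemma cubical_derived_map1 n c : cubical_derived_map n (idm c) = idm _.
Proof.
have e n' (a : bool) i : (0 < i)%N -> (i <= n'.+1)%N ->
    face (X c) n' a i \oc idm _ = idm _ \oc face (X c) n' a i.
  by rewrite comp1m compm1.
rewrite (@cubical_derived_mapE n c c _ (PrecubicalMap e)) /= ?comp1m ?compm1 //.
apply: homology_map1 => m; apply: normal_incl_inj.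
by rewrite normal_incl_map /= fmap1 comp1m compm1.
Qed.

Lemma cubical_derived_mapM n (c d e : C) (g : hom d e) (f : hom c d) :
  cubical_derived_map n (g \oc f) =
  cubical_derived_map n g \oc cubical_derived_map n f.
Proof.
have w m (a : bool) i : (0 < i)%N -> (i <= m.+1)%N ->
    face (X e) m a i \oc (cub_map g m.+1 \oc cub_map f m.+1) =
    (cub_map g m \oc cub_map f m) \oc face (X c) m a i.
  by move=> i0 iN; rewrite compmA pcm_face // -!compmA pcm_face.
rewrite (@cubical_derived_mapE n c e _ (PrecubicalMap w)) /=.
  apply: homology_mapM => m; apply: normal_incl_inj.
  by rewrite compmA !normal_incl_map -compmA normal_incl_map /= fmapM compmA.
by rewrite compmA cub_mapP -!compmA cub_mapP.
Qed.

(* the n-th cubical derived functor of F, computed with the chosen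
   resolutions X *)
Definition cubical_derived n : functor C B :=
  @Functor C B (fun c => homology (cubical_complex_of c) n)
    (cubical_derived_map n) (cubical_derived_map1 n) (@cubical_derived_mapM n).

End CubicalDerived.

(* Main.v *)
(** For [Q] in [P], the sets [Hom(Q, X_n)] form a pseudocubical set over
    [Hom(Q, c)] which has the extension property, as has the constant one on
    [Hom(Q, c)].  The comparison theorem for cubical resolutions therefore
    contracts it onto a constant object by an extra degeneracy [h], whose
    linear extension contracts the normalized complex of the free abelian
    groups [Hom(J Q, J X_n)].  Since [N(X)_n] is a retract of [X_n], [N(X)] is a
    resolution for the closure of [P].  So is the image of any [P]-resolution,
    hence the two are homotopy equivalent over [c].  Extending [F_ad] to the
    idempotent completion and applying it, one concludes because additive
    functors commute with [N]. *)
From HB Require Import structures.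
From mathcomp Require Import all_boot all_algebra.
From mathcomp Require Import boolp classical_sets freeg.
Require Import Defs.

Set Implicit Arguments.
Unset Strict Implicit.
Unset Printing Implicit Defensive.

Import GRing.Theory.
Local Open Scope ring_scope.
Local Open Scope classical_set_scope.

(** * Contraction of the pseudocubical sets Hom(Q, X) onto constant ones *)

Section HomContraction.

(* Stands for the category of sets as the target of [Hom(Q, -)]: the type of
   objects and the hom-types of a [category] share one universe, so that the
   category of all types is not available. *)
Definition hom_category (C : category) (Q : C) : category :=
  @Category C (fun X Y => hom Q X -> hom Q Y) (fun _ => id)
    (fun _ _ _ g f => g \o f)
    (fun _ _ _ => erefl) (fun _ _ _ => erefl) (fun _ _ _ _ _ _ _ => erefl).

Definition hom_functor (C : category) (Q : C) : functor C (hom_category Q).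
Proof.
refine (@Functor C (hom_category Q) (fun X => X)
  (fun X Y f (u : hom Q X) => f \oc u) _ _).
  by move=> X; apply/funext => u; exact: comp1m.
by move=> X Y Z g f; apply/funext => u; rewrite -compmA.
Defined.

(** A morphism out of [T] in [hom_category Q] is a function on Hom(Q, T), so each extension problem
    is solved value by value and the solutions are assembled by choice. Every object therefore
    behaves as a projective one, which is why the class is [setT]. *)
Lemma hom_functor_exact (C : category) (P : set C) (c : C)
    (X : cubical_resolution P c) (Q : C) : P Q ->
  aug_class_exact setT (X := map_pseudocubical (hom_functor Q) X)
    (fmap (hom_functor Q) (cub_aug X)).
Proof.
move=> PQ T _; have [ex0 ex1 exS] := cub_exact X PQ; split.
- move=> y; have [x xP] := choice (fun t => ex0 (y t)).
  by exists x; apply/funext.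
- move=> x y xy.
  have xyE t : cub_aug X \oc x t = cub_aug X \oc y t.
    exact: (congr1 (fun f => f t) xy).
  have [z zP] := choice (fun t => ex1 _ _ (xyE t)).
  by exists z; split; apply/funext => t; case: (zP t).
move=> n x xP.
have xE t i j a e (i0 : (0 < i)%N) (ij : (i < j)%N) (jN : (j <= n.+2)%N) :
    face X n a i \oc x j e t = face X n e j.-1 \oc x i a t.
  exact: (congr1 (fun f => f t) (xP i j a e i0 ij jN)).
have [z zP] := choice (fun t => exS n (fun i a => x i a t) (xE t)).
by exists z => i e i0 iN; apply/funext => t; exact: zP.
Qed.

Definition hom_resolution (C : category) (P : set C) (c : C)
    (X : cubical_resolution P c) (Q : C) (PQ : P Q) :
  cubical_resolution setT (hom_functor Q c).
Proof.
refine (@CubicalResolution _ setT _ (map_pseudocubical (hom_functor Q) X)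
  (fmap (hom_functor Q) (cub_aug X)) _ _ _).
- by rewrite /is_augmentation -!fmapM (cub_augP X).
- by [].
- exact: hom_functor_exact.
Defined.

Definition const_pseudocubical (C : category) (c : C) : pseudocubical C.
Proof.
refine (@Pseudocubical C (fun _ => c) (fun _ _ _ => idm c)
  (fun _ _ => idm c) _ _ _ _) => // *; exact: comp1m.
Defined.

Definition const_resolution (C : category) (c : C) : cubical_resolution setT c.
Proof.
refine (@CubicalResolution _ setT c (const_pseudocubical c) (idm c) _ _ _) => //.
move=> Q _; split=> [y|x y|n x xP]; first by exists y; rewrite comp1m.
  by rewrite !comp1m => ->; exists y; rewrite comp1m.
(* The compatibility relations with first index 1 identify every later [x j e'] with both [x 1 true]
   and [x 1 false]. There are at least two directions, so the latter two agree through
   [x 2 true]. *)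
exists (x 1%N true) => i e i0 iN.
have xE j e' a : (1 < j)%N -> (j <= n.+2)%N -> x j e' = x 1%N a.
  by move=> j1 jN; have := xP 1%N j a e' isT j1 jN; rewrite !comp1m.
rewrite /= comp1m; have [->|i1] := eqVneq i 1%N; last first.
  by rewrite (xE i e true) // ltn_neqAle eq_sym i1.
by rewrite -(xE 2%N true true) // (xE 2%N true e).
Defined.

(** The identity of [X] and the composite of the two comparison maps both lie over the identity of
    [c], so the uniqueness part of the comparison theorem gives [h]. *)
Lemma cubical_resolution_homotopic (C : category) (P : set C) (c : C)
    (X Y : cubical_resolution P c) :
  exists (u : precubical_map X Y) (v : precubical_map Y X)
         (h : forall n, hom (X n) (X n.+1)),
  [/\ cub_aug Y \oc u 0 = cub_aug X,
      forall n, face X n false 1 \oc h n = idm (X n),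
      forall n, face X n true 1 \oc h n = v n \oc u n &
      forall n (a : bool) i, (0 < i)%N -> (i <= n.+1)%N ->
        face X n.+1 a i.+1 \oc h n.+1 = h n \oc face X n a i].
Proof.
have [u uP] := cubical_lift X Y (idm c).
have [v vP] := cubical_lift Y X (idm c).
have idF n a i : (0 < i)%N -> (i <= n.+1)%N ->
    face X n a i \oc idm _ = idm _ \oc face X n a i.
  by rewrite comp1m compm1.
have vuF n a i : (0 < i)%N -> (i <= n.+1)%N ->
    face X n a i \oc (v n.+1 \oc u n.+1) = (v n \oc u n) \oc face X n a i.
  by move=> i0 iN; rewrite compmA pcm_face // -!compmA pcm_face.
have [|h [h0 h1 hS]] := @cubical_homotopic _ _ _ _ X X
    (PrecubicalMap idF) (PrecubicalMap vuF).
  by rewrite /= compmA vP comp1m uP comp1m compm1.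
by exists u, v, h; split=> //; rewrite uP comp1m.
Qed.

(** Here [q] and [k] compare Hom(Q, X) with the constant object on Hom(Q, c), and [h] acts as an
    extra degeneracy: its 0-face in the new direction is the identity, its 1-face factors through
    Hom(Q, c). *)
Lemma hom_contraction (C : category) (P : set C) (c : C)
    (X : cubical_resolution P c) (Q : C) (PQ : P Q) :
  exists (q : forall n, hom Q (X n) -> hom Q c)
         (k : forall n, hom Q c -> hom Q (X n))
         (h : forall n, hom Q (X n) -> hom Q (X n.+1)),
  [/\ forall x, q 0 x = cub_aug X \oc x,
      forall n a i x, (0 < i)%N -> (i <= n.+1)%N ->
        q n.+1 x = q n (face X n a i \oc x),
      forall n x, face X n false 1 \oc h n x = x,
      forall n x, face X n true 1 \oc h n x = k n (q n x) &
      forall n a i x, (0 < i)%N -> (i <= n.+1)%N ->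
        face X n.+1 a i.+1 \oc h n.+1 x = h n (face X n a i \oc x)].
Proof.
have [q [k [h [q0 h0 h1 hS]]]] := cubical_resolution_homotopic
  (hom_resolution X PQ) (const_resolution (hom_functor Q c)).
have app S T (f g : hom Q S -> hom Q T) : f = g -> forall x, f x = g x.
  by move=> ->.
exists q, k, h; split.
- exact: app q0.
- by move=> n a i x i0 iN; exact: app (pcm_face q a i0 iN) x.
- by move=> n; exact: app (h0 n).
- by move=> n; exact: app (h1 n).
- by move=> n a i x i0 iN; exact: app (hS n a i i0 iN) x.
Qed.

End HomContraction.

(** * Additive functors, and the splitting of the idempotent sigma by N(X) *)

Lemma afunB (A B : preadditive) (G : additive_functor A B) (X Y : A)
    (f g : hom X Y) : fmap G (f - g) = fmap G f - fmap G g.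
Proof. by apply/eqP; rewrite eq_sym subr_eq -afunD subrK. Qed.

HB.instance Definition _ (A B : preadditive) (G : additive_functor A B)
    (X Y : A) :=
  GRing.isZmodMorphism.Build (hom X Y) (hom (G X) (G Y)) (@fmap A B G X Y)
    (@afunB A B G X Y).

Section NormalizedRetract.
Variables (A : preadditive) (X : pseudocubical A) (hA : idempotent_complete A).

Definition normal_retr n : hom (X n) (normalized X hA n) :=
  normal_lift hA (@sigma_normal _ X n).

Lemma normal_inclK n : normal_incl X hA n \oc normal_retr n = pc_sigma X n.
Proof. exact: normal_liftE. Qed.

Lemma sigma_incl n : pc_sigma X n \oc normal_incl X hA n = normal_incl X hA n.
Proof.
have /normalP := @normal_incl_normal _ X hA n.
by rewrite compBm comp1m => /eqP; rewrite subr_eq0 => /eqP <-.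
Qed.

Lemma normal_retrK n : normal_retr n \oc normal_incl X hA n = idm _.
Proof.
by apply: normal_incl_inj; rewrite compmA normal_inclK sigma_incl compm1.
Qed.

End NormalizedRetract.

(** * Linear extension of set maps, and acyclicity of the normalized complex *)

Section Linearization.
Variables (C : category) (A : preadditive).
Variable I : additive_functor (free_preadditive C) A.
Hypothesis fullI : forall (X Y : free_preadditive C) (g : hom (I X) (I Y)),
  exists f : hom X Y, fmap I f = g.
Hypothesis faithfulI : forall (X Y : free_preadditive C) (f g : hom X Y),
  fmap I f = fmap I g -> f = g.

Let J : functor C A := compF I (free_incl C).

Definition full_preim (X Y : free_preadditive C) (g : hom (I X) (I Y)) :
  hom X Y := projT1 (cid (fullI g)).

Lemma full_preimK (X Y : free_preadditive C) (g : hom (I X) (I Y)) :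
  fmap I (full_preim g) = g.
Proof. by rewrite /full_preim; case: cid. Qed.

Lemma fmap_preimK (X Y : free_preadditive C) (f : hom X Y) :
  full_preim (fmap I f) = f.
Proof. by apply: faithfulI; rewrite full_preimK. Qed.

(* [hom (J Q) (J X)] is free abelian on [hom Q X]; this is the additive map
   induced by a map of bases. *)
Definition linearize (Q X Y : C) (g : hom Q X -> hom Q Y)
    (x : hom (J Q) (J X)) : hom (J Q) (J Y) :=
  fmap I (free_lift (fun u => << (g u : {classic hom Q Y}) >>) (full_preim x)
          : @hom (free_preadditive C) Q Y).

(** Together with [linearizeM], this carries identities between set maps, such as those of
    [hom_contraction], over to the free abelian groups. *)
Lemma linearize_comp (Q X Y : C) (f : hom X Y) (x : hom (J Q) (J X)) :
  linearize (fun u => f \oc u) x = fmap J f \oc x.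
Proof.
rewrite -[in RHS](full_preimK x) /J /= -fmapM; congr (fmap I _).
by rewrite /= /free_comp free_liftU.
Qed.

Lemma linearize_id (Q X : C) (x : hom (J Q) (J X)) : linearize id x = x.
Proof.
have -> : id = (fun u : hom Q X => idm X \oc u).
  by apply/funext => u; rewrite comp1m.
by rewrite linearize_comp fmap1 comp1m.
Qed.

Lemma linearizeM (Q X Y Z : C) (g : hom Q Y -> hom Q Z)
    (f : hom Q X -> hom Q Y) (x : hom (J Q) (J X)) :
  linearize g (linearize f x) = linearize (g \o f) x.
Proof.
rewrite /linearize fmap_preimK; congr (fmap I _).
elim/freegW: (full_preim x) => [|D1 D2 e1 e2|D e|t].
- by rewrite !free_lift0.
- by rewrite !free_liftD e1 e2.
- by rewrite !free_liftN e.
- by rewrite !free_liftU.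
Qed.

Lemma linearize_subproof (Q X Y : C) (g : hom Q X -> hom Q Y) :
  {morph linearize g : x y / x - y}.
Proof.
move=> x y; rewrite /linearize -afunB; congr (fmap I _).
have -> : full_preim (x - y) = full_preim x - full_preim y.
  by apply: faithfulI; rewrite afunB !full_preimK.
by rewrite -free_liftN -free_liftD.
Qed.

HB.instance Definition _ (Q X Y : C) (g : hom Q X -> hom Q Y) :=
  GRing.isZmodMorphism.Build _ _ (linearize g) (linearize_subproof g).

Hypothesis hA : idempotent_complete A.

(** In positive degrees the linear extension of [h] preserves normal elements and satisfies d h x =
    x - h d x on them, so it contracts the complex. In degree 0 this works for elements killed by
    the augmentation. *)
Lemma normalized_acyclic (P : set C) (c : C) (X : cubical_resolution P c)
    (Q : C) (PQ : P Q) :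
  let K := normalized (map_pseudocubical J X) hA in
  let e := normal_aug (X := map_pseudocubical J X) hA (fmap J (cub_aug X)) in
  [/\ forall y : hom (J Q) (J c), exists x : hom (J Q) (K 0), e \oc x = y,
      forall y : hom (J Q) (K 0), e \oc y = 0 ->
        exists x : hom (J Q) (K 1%N), chain_diff K 0 \oc x = y &
      forall n (y : hom (J Q) (K n.+1)), chain_diff K n \oc y = 0 ->
        exists x : hom (J Q) (K n.+2), chain_diff K n.+1 \oc x = y].
Proof.
move=> K e; pose JX := map_pseudocubical J X.
have [q [k [h [q0 qS h0 h1 hS]]]] := hom_contraction X PQ.
have lin_face0 n (x : hom (J Q) (J (X n))) :
    face JX n false 1 \oc linearize (h n) x = x.
  rewrite -linearize_comp linearizeM -[RHS]linearize_id.
  by congr linearize; apply/funext => u; exact: h0.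
have lin_face1 n (x : hom (J Q) (J (X n))) :
    face JX n true 1 \oc linearize (h n) x =
    linearize (k n) (linearize (q n) x).
  rewrite -linearize_comp !linearizeM.
  by congr linearize; apply/funext => u; exact: h1.
have lin_faceS n a i (x : hom (J Q) (J (X n.+1))) :
    (0 < i)%N -> (i <= n.+1)%N ->
    face JX n.+1 a i.+1 \oc linearize (h n.+1) x =
    linearize (h n) (face JX n a i \oc x).
  move=> i0 iN; rewrite -!linearize_comp !linearizeM.
  by congr linearize; apply/funext => u; exact: hS.
have lin_q0 (x : hom (J Q) (J (X 0))) :
    linearize (q 0) x = fmap J (cub_aug X) \oc x.
  by rewrite -linearize_comp; congr linearize; apply/funext.
have lin_qS n a i (x : hom (J Q) (J (X n.+1))) :
    (0 < i)%N -> (i <= n.+1)%N ->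
    linearize (q n.+1) x = linearize (q n) (face JX n a i \oc x).
  move=> i0 iN; rewrite -linearize_comp linearizeM.
  by congr linearize; apply/funext => u; exact: qS.
split.
- move=> y; have [ex0 _ _] := cub_exact X PQ; have [s sP] := choice ex0.
  (* A set-theoretic section [s] of Hom(Q, X_0) -> Hom(Q, c) becomes additive once extended from the
     basis. *)
  have xN : pc_normal (X := JX) (n := 0) (linearize s y) by [].
  exists (normal_lift hA xN); rewrite -compmA normal_liftE.
  rewrite -linearize_comp linearizeM -[RHS]linearize_id.
  by congr linearize; apply/funext.
- move=> y ey; pose x := normal_incl JX hA 0 \oc y.
  (* The only 1-face of [h x] is [k (q x)], and [q 0] is composition with the augmentation, which
     kills [x]. *)
  have xN : pc_normal (X := JX) (n := 1%N) (linearize (h 0) x).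
    move=> i; case: i => [|[|i]] // _ _.
    by rewrite lin_face1 lin_q0 compmA [_ \oc y]ey raddf0.
  exists (normal_lift hA xN); apply: (@normal_incl_inj _ JX).
  rewrite compmA normal_incl_diff -compmA normal_liftE boundary_normalE //.
  by rewrite big_nat1 expr1 mulrNz opprK mulr1z lin_face0.
move=> n y dy; pose x := normal_incl JX hA n.+1 \oc y.
have x0 i : (0 < i)%N -> (i <= n.+1)%N -> face JX n true i \oc x = 0.
  move=> i0 iN; rewrite compmA (@normal_incl_normal _ JX hA n.+1) //.
  by rewrite comp0m.
have dx : pc_boundary JX n \oc x = 0.
  by rewrite compmA -normal_incl_diff -compmA dy compm0.
(* The first 1-face vanishes because [q] is unchanged by passing to a face and [x] has zero 1-faces;
   the others are images under [h] of 1-faces of [x]. *)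
have xN : pc_normal (X := JX) (n := n.+2) (linearize (h n.+1) x).
  case=> [|[|i]] // _ iN.
    by rewrite lin_face1 (lin_qS n true 1%N) // x0 // !raddf0.
  by rewrite lin_faceS // x0 // raddf0.
exists (normal_lift hA xN); apply: (@normal_incl_inj _ JX).
rewrite compmA normal_incl_diff -compmA normal_liftE boundary_normalE //.
rewrite big_ltn // expr1 mulrNz opprD opprK mulr1z lin_face0.
rewrite -[RHS]addr0; congr (_ + _).
(* The term of index 1 in the boundary of [h x] was [x] itself. The remaining ones, shifted by one
   index, add up to minus [h] of the boundary of [x], which is zero. *)
have hx0 : linearize (h n)
    (\sum_(1 <= i < n.+2) (face JX n false i \oc x) *~ (-1) ^+ i) = 0.
  by rewrite -[X in linearize _ X]opprK -boundary_normalE // dx oppr0 raddf0.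
rewrite -sumrN big_add1 [n.+3.-1]/= -[RHS]hx0 raddf_sum.
rewrite big_seq [RHS]big_seq; apply: eq_bigr => i.
rewrite mem_index_iota => /andP[i0 iN].
by rewrite lin_faceS // exprS mulN1r mulrNz opprK raddfMz.
Qed.

End Linearization.

(** * Closures of classes of objects, and the two resolutions for the closure *)

Section Closure.
Variables (A : preadditive) (P : set A).

Lemma subset_closure : P `<=` class_closure P.
Proof. by move=> Q PQ X Y Z f g [_ /(_ Q PQ)]. Qed.

(** A map [y] out of [Y] is extended to [y \oc r] out of [X], lifted there, and the lift is
    restricted along [i]. *)
Lemma closure_retract (X Y : A) (i : hom Y X) (r : hom X Y) :
  r \oc i = idm Y -> class_closure P X -> class_closure P Y.
Proof.
move=> ri PX U V W f g fg y; split=> [gy|[x <-]].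
  have [x xE] : exists x, f \oc x = y \oc r.
    by apply/(PX _ _ _ _ _ fg); rewrite compmA gy comp0m.
  by exists (x \oc i); rewrite compmA xE -compmA ri compm1.
by rewrite compmA fg.1 comp0m.
Qed.

(** Acyclicity splits into exactness of three-term sequences, and the closure is defined by
    inheriting exactly these. Hence it suffices to test on [P] itself. *)
Lemma closure_resolution (X : A) (K : chain_complex A) (e : hom (K 0) X) :
  e \oc chain_diff K 0 = 0 -> (forall n, class_closure P (K n)) ->
  (forall Q, P Q ->
    [/\ forall y : hom Q X, exists x : hom Q (K 0), e \oc x = y,
        forall y : hom Q (K 0), e \oc y = 0 ->
          exists x : hom Q (K 1%N), chain_diff K 0 \oc x = y &
        forall n (y : hom Q (K n.+1)), chain_diff K n \oc y = 0 ->
          exists x : hom Q (K n.+2), chain_diff K n.+1 \oc x = y]) ->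
  is_resolution (class_closure P) e.
Proof.
move=> ed PK acK; split=> // Q PQ.
have exact U V W (f : hom U V) (g : hom V W) : g \oc f = 0 ->
    (forall R, P R -> forall y : hom R V, g \oc y = 0 ->
       exists x : hom R U, f \oc x = y) -> hom_exact Q f g.
  move=> gf fg; apply: PQ; split=> // R PR y; split; first exact: fg.
  by move=> [x <-]; rewrite compmA gf comp0m.
split.
(* Surjectivity onto Hom(Q, X) is exactness at [X]; the zero endomorphism of [X] replaces the map to
   a zero object, which [A] may lack. *)
- move=> y; apply/(exact _ _ _ _ (0 : hom X X)); first exact: comp0m.
    by move=> R /acK [ex0 _ _] z _; exact: ex0.
  exact: comp0m.
- by apply: exact => // R /acK [].
- move=> n; apply: exact; first exact: diffK.
  by move=> R /acK [_ _ exS]; exact: exS.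
Qed.

End Closure.

Lemma normalized_resolution (C : category) (P : set C) (A : preadditive)
    (I : additive_functor (free_preadditive C) A)
    (complA : idempotent_completion I) (c : C) (X : cubical_resolution P c) :
  let J : functor C A := compF I (free_incl C) in
  is_resolution (class_closure [set J Q | Q in P])
    (normal_aug (X := map_pseudocubical J X) (compl_complete complA)
       (fmap J (cub_aug X))).
Proof.
move=> J; pose JX := map_pseudocubical J X; apply: closure_resolution.
- rewrite /normal_aug -compmA normal_incl_diff compmA /pc_boundary.
  by rewrite big_nat1 compmz compmB -!fmapM cub_augP subrr mul0rz comp0m.
- move=> n; apply: (closure_retract (normal_retrK JX (compl_complete complA) n)).
  by apply: subset_closure; exists (X n) => //; exact: cub_proj.
move=> _ [Q PQ <-].
exact: (normalized_acyclic (compl_full complA) (compl_faithful complA)).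
Qed.

(** As [I] is fully faithful, Hom(I Q, I -) is Hom(Q, -), so acyclicity is preserved. Passing to the
    closure puts the image in the same class of resolutions as N(X). *)
Lemma map_closure_resolution (A A' : preadditive) (I : additive_functor A A')
    (P : set A) (X : A) (K : chain_complex A)
    (e : hom (K 0) X) :
  (forall (X Y : A) (g : hom (I X) (I Y)), exists f : hom X Y, fmap I f = g) ->
  (forall (X Y : A) (f g : hom X Y), fmap I f = fmap I g -> f = g) ->
  is_resolution P e ->
  is_resolution (class_closure [set I Q | Q in P])
    (fmap I e : hom (map_complex I K 0) (I X)).
Proof.
move=> fullI faithI [ed PK acK]; apply: closure_resolution.
- by rewrite /= -fmapM ed afun0.
- move=> n; by apply: subset_closure; exists (K n).
move=> _ [Q PQ <-]; have [ex0 ex1 exS] := acK Q PQ.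
have lift (U V W : A) (f : hom U V) (g : hom V W) : hom_exact Q f g ->
    forall y : hom (I Q) (I V), fmap I g \oc y = 0 ->
    exists x, fmap I f \oc x = y.
  move=> fg y; have [z <-] := fullI _ _ y; rewrite -fmapM -(afun0 I).
  by move=> /faithI /fg [x <-]; exists (fmap I x); rewrite -fmapM.
split.
- move=> y; have [z <-] := fullI _ _ y; have [x <-] := ex0 z.
  by exists (fmap I x); rewrite -fmapM.
- exact: lift.
- by move=> n; exact: lift.
Qed.

(** * Isomorphisms, composition of chain maps, and induced maps on homology *)

Section Isomorphisms.
Variable C : category.

Lemma isom_comp (X Y Z : C) (g : hom Y Z) (f : hom X Y) :
  is_isom g -> is_isom f -> is_isom (g \oc f).
Proof.
move=> [g' [g'g gg']] [f' [f'f ff']]; exists (f' \oc g'); split.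
  by rewrite -compmA (compmA g') g'g comp1m.
by rewrite -compmA (compmA f) ff' comp1m.
Qed.

Lemma nat_iso_sym (D : category) (F G : functor C D) :
  nat_iso F G -> nat_iso G F.
Proof.
move=> [t [tI tN]]; pose s X := projT1 (cid (tI X)).
have sP X : s X \oc t X = idm _ /\ t X \oc s X = idm _ := projT2 (cid (tI X)).
exists s; split.
  by move=> X; exists (t X); have [] := sP X.
move=> X Y f; have [_ ts] := sP X; have [st _] := sP Y.
by rewrite -[LHS]comp1m -st -compmA (compmA (t Y)) -tN -!compmA ts compm1.
Qed.

End Isomorphisms.

Section ChainMaps.
Variable A : preadditive.
Implicit Types K L M : chain_complex A.

Lemma comp_chain_subproof K L M (v : chain_map L M) (u : chain_map K L) n :
  chain_diff M n \oc (v n.+1 \oc u n.+1) = (v n \oc u n) \oc chain_diff K n.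
Proof. by rewrite compmA chain_morP -!compmA chain_morP. Qed.

Definition comp_chain K L M (v : chain_map L M) (u : chain_map K L) :
  chain_map K M := ChainMap (comp_chain_subproof v u).

Lemma id_chain_subproof K n :
  chain_diff K n \oc idm (K n.+1) = idm (K n) \oc chain_diff K n.
Proof. by rewrite comp1m compm1. Qed.

Definition id_chain K : chain_map K K := ChainMap (@id_chain_subproof K).

End ChainMaps.

Section HomologyIsomorphisms.
Variable B : abelian.
Implicit Types K L M : chain_complex B.

Lemma homology_map_square K L L' M (a : chain_map K L) (b : chain_map L M)
    (a' : chain_map K L') (b' : chain_map L' M) n :
  (forall m, b m \oc a m = b' m \oc a' m) ->
  homology_map b n \oc homology_map a n =
  homology_map b' n \oc homology_map a' n.
Proof.
move=> ba; rewrite -(homology_mapM (w := comp_chain b a)) //.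
by rewrite -(homology_mapM (w := comp_chain b a)).
Qed.

Lemma homology_map_isom K L (u : chain_map K L) n :
  (forall m, is_isom (u m)) -> is_isom (homology_map u n).
Proof.
move=> uI; pose v m := projT1 (cid (uI m)).
have vP m : v m \oc u m = idm _ /\ u m \oc v m = idm _ := projT2 (cid (uI m)).
have vC m : chain_diff K m \oc v m.+1 = v m \oc chain_diff L m.
  have [vu _] := vP m; have [_ uv] := vP m.+1.
  rewrite -[LHS]comp1m -vu -compmA (compmA (u m)) -chain_morP.
  by rewrite -!compmA uv compm1.
exists (homology_map (ChainMap vC) n); split.
  rewrite -(homology_mapM (w := id_chain K)); first exact: homology_map1.
  by move=> m; have [/= ->] := vP m.
rewrite -(homology_mapM (w := id_chain L)); first exact: homology_map1.
by move=> m; have [_ /= ->] := vP m.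
Qed.

End HomologyIsomorphisms.

(** * Independence of the resolution at the level of homology *)

Section DerivedComparison.
Variables (A : preadditive) (P : set A) (B : abelian).
Variable G : additive_functor A B.

(** Both composites are lifts of [f] to chain maps from [K] to [L'], hence chain homotopic, although
    the square need not commute degreewise. *)
Lemma resolution_square (X Y : A) (K L : resolution P X) (K' L' : resolution P Y)
    (f : hom X Y) (u : chain_map K L) (u' : chain_map K' L')
    (a : chain_map K K') (b : chain_map L L') n :
  res_aug L \oc u 0 = res_aug K -> res_aug L' \oc u' 0 = res_aug K' ->
  res_aug K' \oc a 0 = f \oc res_aug K -> res_aug L' \oc b 0 = f \oc res_aug L ->
  homology_map (map_chain G u') n \oc homology_map (map_chain G a) n =
  homology_map (map_chain G b) n \oc homology_map (map_chain G u) n.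
Proof.
move=> uP u'P aP bP.
rewrite -(homology_mapM (w := map_chain G (comp_chain u' a))); last first.
  by move=> m; rewrite /= fmapM.
rewrite -(homology_mapM (w := map_chain G (comp_chain b u))); last first.
  by move=> m; rewrite /= fmapM.
apply: homology_map_homotopic; apply: map_chain_homotopic.
apply: resolution_homotopic.
by rewrite /= !compmA u'P aP bP -compmA uP.
Qed.

Lemma resolution_endo (X : A) (K : resolution P X) (w : chain_map K K) n :
  res_aug K \oc w 0 = res_aug K -> homology_map (map_chain G w) n = idm _.
Proof.
move=> wP; transitivity (homology_map (map_chain G (id_chain K)) n).
  apply: homology_map_homotopic; apply: map_chain_homotopic.
  by apply: resolution_homotopic; rewrite wP /= compm1.
by apply: homology_map1 => m; rewrite /= fmap1.
Qed.

(** A lift of the identity in the other direction is an inverse up to homotopy. *)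
Lemma resolution_isom (X : A) (K L : resolution P X) (u : chain_map K L) n :
  res_aug L \oc u 0 = res_aug K -> is_isom (homology_map (map_chain G u) n).
Proof.
move=> uP; have [v] := resolution_lift L K (idm X); rewrite comp1m => vP.
exists (homology_map (map_chain G v) n); split.
  rewrite -(homology_mapM (w := map_chain G (comp_chain v u))) => [|m].
    by apply: resolution_endo; rewrite /= compmA vP.
  by rewrite /= fmapM.
rewrite -(homology_mapM (w := map_chain G (comp_chain u v))) => [|m].
  by apply: resolution_endo; rewrite /= compmA uP.
by rewrite /= fmapM.
Qed.

End DerivedComparison.

(** * Compatibility of normalization with additive functors *)

Section NormalizedFunctor.
Variables (A B : preadditive) (G : additive_functor A B).
Variables (hA : idempotent_complete A) (hB : idempotent_complete B).

Lemma map_pc_sigma (X : pseudocubical A) n :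
  fmap G (pc_sigma X n) = pc_sigma (map_pseudocubical G X) n.
Proof.
case: n => [|n] /=; first exact: fmap1.
rewrite (big_morph (fmap G) (fun _ _ => fmapM G _ _) (fmap1 G _)).
by apply: eq_bigr => i _; rewrite afunB fmap1 fmapM.
Qed.

Lemma map_pc_normal (X : pseudocubical A) n (Q : A) (x : hom Q (X n)) :
  pc_normal x -> pc_normal (X := map_pseudocubical G X) (fmap G x).
Proof.
move/normalP => x0; apply/normalP.
by rewrite -map_pc_sigma -(fmap1 G) -afunB -fmapM x0 afun0.
Qed.

(** The canonical comparison G(N(X)) -> N(G(X)), obtained by factoring the image under [G] of the
    inclusion N(X) -> X. *)
Definition map_normalized_mor (X : pseudocubical A) n :
    hom (map_complex G (normalized X hA) n)
        (normalized (map_pseudocubical G X) hB n) :=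
  normal_lift hB (map_pc_normal (normal_incl_normal X hA n)).

Lemma map_normalized_morE (X : pseudocubical A) n :
  normal_incl (map_pseudocubical G X) hB n \oc map_normalized_mor X n =
  fmap G (normal_incl X hA n).
Proof. exact: normal_liftE. Qed.

Lemma map_pc_boundary (X : pseudocubical A) n :
  fmap G (pc_boundary X n) = pc_boundary (map_pseudocubical G X) n.
Proof.
rewrite raddf_sum; apply: eq_bigr => i _.
by rewrite raddfMz raddfB.
Qed.

Lemma map_normalized_subproof (X : pseudocubical A) n :
  chain_diff (normalized (map_pseudocubical G X) hB) n \oc
    map_normalized_mor X n.+1 =
  map_normalized_mor X n \oc chain_diff (map_complex G (normalized X hA)) n.
Proof.
apply: normal_incl_inj; rewrite !compmA normal_incl_diff map_normalized_morE.
rewrite -compmA map_normalized_morE -map_pc_boundary -!fmapM.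
by rewrite -normal_incl_diff.
Qed.

Definition map_normalized (X : pseudocubical A) :
  chain_map (map_complex G (normalized X hA))
            (normalized (map_pseudocubical G X) hB) :=
  ChainMap (map_normalized_subproof X).

(* The kernel of [1 - sigma] is split, so every additive functor preserves it. *)
Lemma map_normalized_isom (X : pseudocubical A) n :
  is_isom (map_normalized X n).
Proof.
exists (fmap G (normal_retr X hA n) \oc normal_incl (map_pseudocubical G X) hB n).
split; first by rewrite -compmA map_normalized_morE -fmapM normal_retrK fmap1.
apply: normal_incl_inj; rewrite !compmA map_normalized_morE -fmapM normal_inclK.
by rewrite map_pc_sigma sigma_incl compm1.
Qed.

Lemma map_normalized_nat (X Y : pseudocubical A) (u : precubical_map X Y) n :
  map_normalized Y n \oc map_chain G (normalized_map hA u) n =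
  normalized_map hB (map_precubical G u) n \oc map_normalized X n.
Proof.
apply: normal_incl_inj; rewrite !compmA map_normalized_morE normal_incl_map.
by rewrite -compmA map_normalized_morE -!fmapM normal_incl_map.
Qed.

End NormalizedFunctor.

(** The degreewise inverses commute with faces automatically, and so form a precubical map to which
    N applies. *)
Lemma normalized_map_isom (A : preadditive) (hA : idempotent_complete A)
    (X Y : pseudocubical A) (u : precubical_map X Y) n :
  (forall m, is_isom (u m)) -> is_isom (normalized_map hA u n).
Proof.
move=> uI; pose v m := projT1 (cid (uI m)).
have vP m : v m \oc u m = idm _ /\ u m \oc v m = idm _ := projT2 (cid (uI m)).
have vF m a i : (0 < i)%N -> (i <= m.+1)%N ->
    face X m a i \oc v m.+1 = v m \oc face Y m a i.
  move=> i0 iN; have [vu _] := vP m; have [_ uv] := vP m.+1.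
  rewrite -[LHS]comp1m -vu -compmA (compmA (u m)) -pcm_face //.
  by rewrite -!compmA uv compm1.
exists (normalized_map hA (PrecubicalMap vF) n); have [vu uv] := vP n.
split; apply: normal_incl_inj; rewrite compmA !normal_incl_map -compmA.
  by rewrite normal_incl_map /= compmA vu comp1m compm1.
by rewrite normal_incl_map /= compmA uv comp1m compm1.
Qed.

(** * Comparison of cubical and Eilenberg-Moore derived functors *)

(** With [G] extending F_ad along [I], the isomorphism is induced on homology by F_ad(R) -> G(I(R))
    -> G(N(JX)) -> N(G(JX)) -> N(F(X)). The second map is a homotopy equivalence, the others are
    degreewise isomorphisms. *)
Lemma derived_functors_iso (C : category) (P : set C) (B : abelian)
    (F : functor C B) (A : preadditive)
    (I : additive_functor (free_preadditive C) A)
    (complA : idempotent_completion I)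
    (X : forall c : C, cubical_resolution P c)
    (R : forall c : free_preadditive C, @resolution (free_preadditive C) P c)
    (n : nat) :
  nat_iso (cubical_derived F X n)
          (compF (left_derived (free_ext F) R n) (free_incl C)).
Proof.
pose J : functor C A := compF I (free_incl C).
pose hA := compl_complete complA; pose hB := abelian_idempotent_complete B.
apply: nat_iso_sym; have [G GI] := compl_extend complA (free_ext F) hB.
have [s [sI sN]] := nat_iso_sym GI; have {GI} [t [tI tN]] := GI.
have FE c d (f : hom c d) : fmap (free_ext F) (fmap (free_incl C) f) = fmap F f.
  exact: free_liftU.
pose JX c := map_pseudocubical J (X c).
pose S c : chain_map (map_complex (free_ext F) (R c))
    (map_complex G (map_complex I (R c))) :=
  @ChainMap B (map_complex (free_ext F) (R c)) (map_complex G (map_complex I (R c)))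
    (fun m => s (R c m)) (fun m => sN _ _ (chain_diff (R c) m)).
have TF c m a i : (0 < i)%N -> (i <= m.+1)%N ->
    face (map_pseudocubical F (X c)) m a i \oc t (X c m.+1) =
    t (X c m) \oc face (map_pseudocubical G (JX c)) m a i.
  by move=> _ _; rewrite /= -FE; exact: tN.
pose T c : precubical_map (map_pseudocubical G (JX c)) (map_pseudocubical F (X c))
  := @PrecubicalMap B (map_pseudocubical G (JX c)) (map_pseudocubical F (X c))
    (fun m => t (X c m)) (TF c).
(* Over this common class both I(R c) and N(JX c) are resolutions of [J c], so a lift [w] of the
   identity compares them. *)
pose Pbar := class_closure [set J Q | Q in P].
pose K c : resolution Pbar (J c) := Resolution (map_closure_resolution
  (compl_full complA) (compl_faithful complA) (res_resolution (R c))).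
pose N c : resolution Pbar (J c) :=
  Resolution (normalized_resolution complA (X c)).
pose w c : chain_map (K c) (N c) := projT1 (cid (resolution_lift (K c) (N c) (idm _))).
have wP c : res_aug (N c) \oc w c 0 = res_aug (K c).
  by rewrite /w; case: cid => u /= ->; rewrite comp1m.
pose hS c := homology_map (S c) n.
pose hw c := homology_map (map_chain G (w c)) n.
pose hG c := homology_map (map_normalized G hA hB (JX c)) n.
pose hT c := homology_map (normalized_map hB (T c)) n.
exists (fun c => hT c \oc hG c \oc hw c \oc hS c); split.
  move=> c; apply: isom_comp; last by apply: homology_map_isom => m; exact: sI.
  apply: isom_comp; last exact: (@resolution_isom _ _ _ G _ (K c) (N c) (w c) n (wP c)).
  apply: isom_comp; apply: homology_map_isom => m.
    by apply: normalized_map_isom => m'; exact: tI.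
  exact: map_normalized_isom.
move=> c d f.
(* Naturality is pasted from one square per map. Only [ew] relies on a chain homotopy, since [r] and
   [x] are lifts chosen independently; the other three squares commute degreewise. *)
pose r := res_map R (fmap (free_incl C) f); pose x := cub_map X f.
have eS : homology_map (map_chain G (map_chain I r)) n \oc hS c =
          hS d \oc homology_map (map_chain (free_ext F) r) n.
  by apply: homology_map_square => m; exact: sN.
have ew : homology_map (map_chain G (normalized_map hA (map_precubical J x))) n
          \oc hw c = hw d \oc homology_map (map_chain G (map_chain I r)) n.
  apply/esym.
  apply: (@resolution_square _ _ _ G _ _ (K c) (N c) (K d) (N d) (fmap J f)) => //.
    have := congr1 (fmap I) (res_mapP R (fmap (free_incl C) f)).
    by rewrite !fmapM.
  rewrite /= /normal_aug -compmA normal_incl_map !compmA.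
  congr (_ \oc _); have := congr1 (fmap J) (cub_mapP X f).
  by rewrite !fmapM.
have eG : homology_map (normalized_map hB (map_precubical G (map_precubical J x))) n
          \oc hG c =
    hG d \oc homology_map (map_chain G (normalized_map hA (map_precubical J x))) n.
  by apply: homology_map_square => m; rewrite map_normalized_nat.
have eT : homology_map (normalized_map hB (map_precubical F x)) n \oc hT c =
    hT d \oc homology_map (normalized_map hB
               (map_precubical G (map_precubical J x))) n.
  apply: homology_map_square => m; apply: normal_incl_inj.
  rewrite !compmA !normal_incl_map -!compmA !normal_incl_map !compmA.
  congr (_ \oc _); rewrite /= -FE; exact: tN.
transitivity (homology_map (normalized_map hB (map_precubical F x)) n \oc
  (hT c \oc hG c \oc hw c \oc hS c)); first by [].
rewrite !compmA eT -(compmA _ _ (hG c)) eG !compmA -(compmA _ _ (hw c)) ew.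
by rewrite !compmA -(compmA _ _ (hS c)) eS !compmA.
Qed.

(** The completion [I] is any functor with the universal property, and the resolutions [X] and [R]
    are arbitrary choices. As [free_preadditive C] has the objects of [C], the same [P] serves as a
    class in both. *)
Theorem proposition5p5 (C : category) (P : set C) (B : abelian)
    (F : functor C B)
    (A : preadditive) (I : additive_functor (free_preadditive C) A)
    (finC : has_finite_limits C) (projP : projective_class P)
    (complA : idempotent_completion I) :
  let J : functor C A := compF I (free_incl C) in
  (forall (c : C) (X : cubical_resolution P c),
     is_resolution (class_closure [set J Q | Q in P])
       (normal_aug (X := map_pseudocubical J X) (compl_complete complA)
          (fmap J (cub_aug X)))) /\
  (forall (X : forall c : C, cubical_resolution P c)
          (R : forall c : free_preadditive C,
                 @resolution (free_preadditive C) P c)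
          (n : nat),
     nat_iso (cubical_derived F X n)
             (compF (left_derived (free_ext F) R n) (free_incl C))).
Proof.
split=> [c X|X R n]; first exact: normalized_resolution.
exact: derived_functors_iso complA X R n.
Qed.
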